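(* Let $K$ be either $\mathbb C$ or $\mathbb R$, let $K\langle x_1,\dots,x_n\rangle$ be the usual ring of convergent power series over $K$ with maximal ideal $\mathfrak m$, and let $f\in\mathfrak m^2\subset K\langle x_1,\dots,x_n\rangle$ with $\operatorname{rank}H(f)=k$. Then $f$ is right equivalent, by an analytic coordinate change (an automorphism of $K\langle x_1,\dots,x_n\rangle$), to $$a_1x_1^2+\dots+a_kx_k^2+g(x_{k+1},\dots,x_n),$$ with $a_i=1$ if $K=\mathbb C$ and $a_i=\pm1$ if $K=\mathbb R$, and $g\in\mathfrak m^3$. The residual part $g$ is an analytic (i.e. convergent) power series that is uniquely determined up to right equivalence in $K\langle x_{k+1},\dots,x_n\rangle$.
   Context: Convergence is with respect to the usual absolute value, so $K\langle x_1,\dots,x_n\rangle$ is $\mathbb C\{x_1,\dots,x_n\}$ or $\mathbb R\{x_1,\dots,x_n\}$. Two convergent power series $f,g$ are right equivalent if $\varphi(f)=g$ for some local $K$-algebra automorphism $\varphi$ of the convergent power series ring, i.e. a substitution $x_i\mapsto\varphi_i$ with convergent $\varphi_i\in\mathfrak m$ and invertible Jacobian determinant at $0$. $H(f)=\big(\frac{\partial^2f}{\partial x_i\partial x_j}(0)\big)_{i,j=1,\dots,n}$ is the Hessian matrix at $0$. It is not assumed that $f$ has an isolated singularity. *)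

(* Defs.v *)
From HB Require Import structures.
From mathcomp Require Import all_boot all_order all_algebra.
From mathcomp Require Import boolp functions reals complex mpoly.

Set Implicit Arguments.
Unset Strict Implicit.
Unset Printing Implicit Defensive.

Import Order.TTheory GRing.Theory Num.Theory.

Local Open Scope ring_scope.

(* The ring K[[x_1, ..., x_n]]: [f m] is the coefficient of x^m. *)
Definition fps (n : nat) (K : Type) : Type := 'X_{1..n} -> K.

HB.instance Definition _ (n : nat) (K : zmodType) :=
  GRing.Zmodule.copy (fps n K) ('X_{1..n} -> K).

Section FormalPowerSeries.
Context (n : nat) (K : comNzRingType).
Implicit Types (f g h : fps n K) (c : K) (m : 'X_{1..n}).

Definition fps_mul f g : fps n K := fun m =>
  \sum_(k : 'X_{1..n < (mdeg m).+1, (mdeg m).+1} | m == (k.1 + k.2)%MM)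
    f k.1 * g k.2.

Definition fps_one : fps n K := fun m => (m == 0%MM)%:R.

Definition fps_scale c f : fps n K := fun m => c * f m.

Definition fps_trunc (d : nat) f : {mpoly K[n]} :=
  \sum_(m : 'X_{1..n < d}) f m *: 'X_[m].

Lemma fps_trunc_coef d f m : (mdeg m < d)%N -> (fps_trunc d f)@_m = f m.
Proof. by move=> lt_md; rewrite mcoeff_mpoly. Qed.

Lemma fps_mul_trunc d f g m : (mdeg m < d)%N ->
  fps_mul f g m = (fps_trunc d f * fps_trunc d g)@_m.
Proof.
move=> lt_md; rewrite mcoeffM; apply: eq_bigr => -[k1 k2] /= _.
by rewrite !fps_trunc_coef //; apply: leq_trans lt_md; apply: bmdeg.
Qed.

Lemma fps_mul_bound d f g m : (mdeg m < d)%N ->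
  fps_mul f g m =
  \sum_(k : 'X_{1..n < d, d} | m == (k.1 + k.2)%MM) f k.1 * g k.2.
Proof.
move=> lt_md; rewrite (fps_mul_trunc f g lt_md) (mcoeff_poly_mul _ _ lt_md).
by apply: eq_bigr => -[k1 k2] /= _; rewrite !fps_trunc_coef ?bmdeg.
Qed.

Lemma fps_mul_trunc_coef d f (p : {mpoly K[n]}) g m : (mdeg m < d)%N ->
  (forall k, (mdeg k < d)%N -> p@_k = g k) ->
  fps_mul f g m = (fps_trunc d f * p)@_m.
Proof.
move=> lt_md pg; rewrite mcoeffM; apply: eq_bigr => -[k1 k2] /= _.
rewrite fps_trunc_coef ?pg //; apply: leq_trans lt_md; exact: bmdeg.
Qed.

Lemma fps_mulC : commutative fps_mul.
Proof.
move=> f g; apply/funext => m.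
by rewrite !(@fps_mul_trunc (mdeg m).+1) // mulrC.
Qed.

Lemma fps_mulA : associative fps_mul.
Proof.
move=> f g h; apply/funext => m; rewrite [fps_mul (fps_mul f g) h]fps_mulC.
pose t := @fps_trunc (mdeg m).+1.
have tM u v k : (mdeg k < (mdeg m).+1)%N -> (t u * t v)@_k = fps_mul u v k.
  by move=> lt_k; rewrite (fps_mul_trunc u v lt_k).
rewrite (fps_mul_trunc_coef f (ltnSn _) (tM g h)).
by rewrite (fps_mul_trunc_coef h (ltnSn _) (tM f g)) mulrA mulrC.
Qed.

Lemma fps_mul1 : left_id fps_one fps_mul.
Proof.
move=> f; apply/funext => m; rewrite fps_mulC.
rewrite (@fps_mul_trunc_coef (mdeg m).+1 f 1) ?mulr1 ?fps_trunc_coef //.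
by move=> k _; rewrite mcoeff1.
Qed.

Lemma fps_mulDl : left_distributive fps_mul +%R.
Proof.
move=> f g h; apply/funext => m; rewrite /fps_mul.
rewrite [RHS](_ : _ = fps_mul f h m + fps_mul g h m) // -big_split /=.
by apply: eq_bigr => k _; rewrite -mulrDl.
Qed.

Lemma fps_one_neq0 : fps_one != 0.
Proof.
apply/eqP => /(congr1 (fun f : fps n K => f 0%MM)) /eqP.
by rewrite /fps_one eqxx; apply/negP; exact: oner_neq0.
Qed.

HB.instance Definition _ := GRing.Zmodule_isComNzRing.Build (fps n K)
  fps_mulA fps_mulC fps_mul1 fps_mulDl fps_one_neq0.

Lemma fps_scaleA a b f : fps_scale a (fps_scale b f) = fps_scale (a * b) f.
Proof. by apply/funext => m; rewrite /fps_scale mulrA. Qed.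

Lemma fps_scale1 : left_id 1 fps_scale.
Proof. by move=> f; apply/funext => m; rewrite /fps_scale mul1r. Qed.

Lemma fps_scaleDr : right_distributive fps_scale +%R.
Proof. by move=> a f g; apply/funext => m; exact: mulrDr. Qed.

Lemma fps_scaleDl f : {morph fps_scale^~ f : a b / a + b}.
Proof. by move=> a b; apply/funext => m; exact: mulrDl. Qed.

HB.instance Definition _ := GRing.Zmodule_isLmodule.Build K (fps n K)
  fps_scaleA fps_scale1 fps_scaleDr fps_scaleDl.

Lemma fps_scaleAl c f g : c *: (f * g) = (c *: f) * g.
Proof.
apply/funext => m; rewrite [LHS]mulr_sumr; apply: eq_bigr => k _.
by rewrite mulrA.
Qed.

HB.instance Definition _ :=
  GRing.Lmodule_isLalgebra.Build K (fps n K) fps_scaleAl.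
HB.instance Definition _ := GRing.Lalgebra_isComAlgebra.Build K (fps n K).

Lemma fps_addE f g m : (f + g) m = f m + g m. Proof. by []. Qed.
Lemma fps_mulE f g m : (f * g) m = fps_mul f g m. Proof. by []. Qed.
Lemma fps_scaleE c f m : (c *: f) m = c * f m. Proof. by []. Qed.

Definition fps_var (i : 'I_n) : fps n K := fun m => (m == U_(i)%MM)%:R.

Definition fps_deriv (i : 'I_n) f : fps n K :=
  fun m => f (m + U_(i))%MM *+ (m i).+1.

End FormalPowerSeries.

Section Convergence.
Context (n : nat) (K : numFieldType).
Implicit Types (f g : fps n K) (eps : 'I_n -> K) (M : K).

(* When K is the field of complex numbers, [0 < e] and [a <= M] with [0 <= a]
   force [e] and [M] to be real. *)
Definition polydisc_bounded f eps M := forall d : nat,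
  \sum_(m : 'X_{1..n < d}) `|f m| * \prod_(i < n) eps i ^+ m i <= M.

(* [f] converges (absolutely) on some closed polydisc around 0; for series with
   nonnegative terms this means that the partial sums are bounded. *)
Definition is_convergent f : Prop :=
  exists eps M, (forall i, 0 < eps i) /\ polydisc_bounded f eps M.

Definition convergent : {pred fps n K} := fun f => `[< is_convergent f >].

Lemma polydisc_bounded_shrink f eps eps' M :
  (forall i, 0 <= eps' i <= eps i) ->
  polydisc_bounded f eps M -> polydisc_bounded f eps' M.
Proof.
move=> le_eps bf d; apply: le_trans (bf d); apply: ler_sum => m _.
apply: ler_wpM2l => //; apply: ler_prod => i _.
have /andP[ge0 le] := le_eps i.
by rewrite exprn_ge0 //= lerXn2r // nnegrE // (le_trans ge0).
Qed.

Lemma common_radius (e e' : K) : 0 < e -> 0 < e' ->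
  exists r, [/\ 0 < r, 0 <= r <= e & 0 <= r <= e'].
Proof.
move=> e0 e'0; have s0 : 0 < e + e' by rewrite addr_gt0.
have r0 : 0 < e * e' / (e + e') by rewrite divr_gt0 ?mulr_gt0.
exists (e * e' / (e + e')); split; rewrite // ltW //=.
  by rewrite ler_pdivrMr // ler_pM2l // lerDr ltW.
by rewrite ler_pdivrMr // mulrC ler_pM2l // lerDl ltW.
Qed.

Lemma convergent_common f g : is_convergent f -> is_convergent g ->
  exists eps M N, [/\ forall i, 0 < eps i,
    polydisc_bounded f eps M & polydisc_bounded g eps N].
Proof.
move=> [e [M [e0 bf]]] [e' [N [e'0 bg]]].
have /choice[r r_spec] i := common_radius (e0 i) (e'0 i).
exists r, M, N; split; first by move=> i; have [] := r_spec i.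
  by apply: polydisc_bounded_shrink bf => i; have [] := r_spec i.
by apply: polydisc_bounded_shrink bg => i; have [] := r_spec i.
Qed.

Lemma convergent_sub f g :
  is_convergent f -> is_convergent g -> is_convergent (f - g).
Proof.
move=> cf cg; have [e [M [N [e0 bf bg]]]] := convergent_common cf cg.
exists e, (M + N); split=> // d; apply: le_trans (lerD (bf d) (bg d)).
rewrite -big_split /=; apply: ler_sum => m _; rewrite -mulrDl.
apply: ler_wpM2r; first by apply: prodr_ge0 => i _; rewrite exprn_ge0 ?ltW.
exact: ler_normB.
Qed.

Lemma convergent_scale c f : is_convergent f -> is_convergent (c *: f).
Proof.
move=> [e [M [e0 bf]]]; exists e, (`|c| * M); split=> // d.
apply: le_trans (ler_wpM2l (normr_ge0 c) (bf d)); rewrite mulr_sumr.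
by apply: ler_sum => m _; rewrite fps_scaleE normrM mulrA.
Qed.

Definition fps_delta (m0 : 'X_{1..n}) : fps n K := fun m => (m == m0)%:R.

Lemma convergent_delta m0 : is_convergent (fps_delta m0).
Proof.
exists (fun=> 1), 1; split=> // d; rewrite /fps_delta.
have one (m : 'X_{1..n}) : \prod_(i < n) (1 : K) ^+ m i = 1.
  by apply: big1 => i _; rewrite expr1n.
under eq_bigr do rewrite one mulr1.
have [lt_d|le_d] := ltnP (mdeg m0) d.
  rewrite (bigD1 (BMultinom lt_d)) //= eqxx normr1 big1 ?addr0 // => m.
  by rewrite bmeqP /= => /negbTE->; rewrite normr0.
rewrite big1 // => m _; case: eqP => [em|_]; last by rewrite normr0.
by move: (bmdeg m); rewrite em ltnNge le_d.
Qed.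

Lemma convergent_one : is_convergent (1 : fps n K).
Proof. exact: convergent_delta. Qed.

Lemma convergent_var i : is_convergent (fps_var K i).
Proof. exact: convergent_delta. Qed.

Lemma convergent_mul f g :
  is_convergent f -> is_convergent g -> is_convergent (f * g).
Proof.
move=> cf cg; have [e [M [N [e0 bf bg]]]] := convergent_common cf cg.
pose w (m : 'X_{1..n}) := \prod_(i < n) e i ^+ m i.
have w0 m : 0 <= w m by apply: prodr_ge0 => i _; rewrite exprn_ge0 ?ltW.
have wD m1 m2 : w (m1 + m2)%MM = w m1 * w m2.
  by rewrite -big_split /=; apply: eq_bigr => i _; rewrite mnmDE exprD.
exists e, (M * N); split=> // d.
have le_MN : (\sum_(m : 'X_{1..n < d}) `|f m| * w m) *
             (\sum_(m : 'X_{1..n < d}) `|g m| * w m) <= M * N.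
  by apply: ler_pM; [apply: sumr_ge0 => m _; rewrite mulr_ge0..| |].
apply: le_trans le_MN; rewrite big_distrlr /= pair_big /=.
apply: (@le_trans _ _ (\sum_(m : 'X_{1..n < d})
   \sum_(k : 'X_{1..n < d, d} | val m == (k.1 + k.2)%MM)
     (`|f k.1| * w k.1) * (`|g k.2| * w k.2))).
  apply: ler_sum => m _; rewrite fps_mulE (fps_mul_bound _ _ (bmdeg m)).
  rewrite -/(w m) -[w m]ger0_norm // -normrM mulr_suml.
  apply: le_trans (ler_norm_sum _ _ _) _; apply: ler_sum => k /eqP ->.
  by rewrite wD !normrM !(ger0_norm (w0 _)) mulrACA.
rewrite (exchange_big_dep predT) //=; apply: ler_sum => k _.
set t := _ * _; have t0 : 0 <= t by rewrite !mulr_ge0.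
have [lt_d|le_d] := ltnP (mdeg (k.1 + k.2)%MM) d.
  by rewrite (big_pred1 (BMultinom lt_d)) // => m; rewrite /= bmeqP.
rewrite big1 // => m /eqP em.
by move: (bmdeg m); rewrite em ltnNge le_d.
Qed.

Lemma convergent_subalg : GRing.subalg_closed convergent.
Proof.
split=> [|c f g /asboolP cf /asboolP cg|f g /asboolP cf /asboolP cg];
  apply/asboolP; first exact: convergent_one; last exact: convergent_mul.
rewrite -[g]opprK; apply: convergent_sub; first exact: convergent_scale.
by rewrite -scaleN1r; exact: convergent_scale.
Qed.

HB.instance Definition _ :=
  GRing.isSubalgClosed.Build K (fps n K) convergent convergent_subalg.

(* The ring K<x_1, ..., x_n> of convergent power series. *)
Record cps : Type :=
  CPS { coef : fps n K; coef_convergent : coef \in convergent }.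

HB.instance Definition _ := [isSub for coef].
HB.instance Definition _ := [Choice of cps by <:].
HB.instance Definition _ := [SubChoice_isSubComNzRing of cps by <:].
HB.instance Definition _ := [SubZmodule_isSubLmodule of cps by <:].
HB.instance Definition _ := [SubNzRing_SubLmodule_isSubLalgebra of cps by <:].
HB.instance Definition _ := [SubLalgebra_isSubAlgebra of cps by <:].

End Convergence.

Section Tail.
Context (n k : nat).

Lemma tail_ord_proof (j : 'I_(n - k)) : (k + j < n)%N.
Proof. by rewrite -ltn_subRL. Qed.

(* Indices start at 0: x_{k+1}, ..., x_n are the variables of index >= k. *)
Definition tail_ord (j : 'I_(n - k)) : 'I_n := Ordinal (tail_ord_proof j).

Definition mnm_tail (m : 'X_{1..n}) : 'X_{1..n - k} :=
  [multinom m (tail_ord j) | j < n - k].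

Definition head_free (m : 'X_{1..n}) : bool :=
  [forall i : 'I_n, (i < k)%N ==> (m i == 0%N)].

(* The inclusion of K[[x_{k+1}, ..., x_n]] in K[[x_1, ..., x_n]]. *)
Definition fps_tail (K : zmodType) (g : fps (n - k) K) : fps n K :=
  fun m => if head_free m then g (mnm_tail m) else 0.

Lemma big_tail (T : Type) (idx : T) (op : Monoid.com_law idx) (F : 'I_n -> T) :
  \big[op/idx]_(i < n | (k <= i)%N) F i =
  \big[op/idx]_(j < n - k) F (tail_ord j).
Proof.
rewrite (eq_bigl (mem [set: 'I_(n - k)])); last by move=> j; rewrite /= inE.
rewrite -(@big_imset _ _ _ _ _ tail_ord _ F) /=; last first.
  move=> j1 j2 _ _ /(congr1 (@nat_of_ord n)) /= /eqP.
  by rewrite eqn_add2l => /eqP /ord_inj.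
apply: eq_bigl => i; apply/idP/imsetP => [le_ki|[j _ ->]]; last exact: leq_addr.
have lt_j : (i - k < n - k)%N by rewrite ltn_sub2r // (leq_ltn_trans le_ki).
by exists (Ordinal lt_j); [rewrite inE|apply: val_inj; rewrite /= subnKC].
Qed.

Lemma mnm_tail_inj : {in head_free &, injective mnm_tail}.
Proof.
move=> m1 m2 /forallP h1 /forallP h2 /mnmP e; apply/mnmP => i.
have [lt_ik|le_ki] := ltnP i k.
  by move: (h1 i) (h2 i); rewrite lt_ik => /eqP-> /eqP->.
have lt_j : (i - k < n - k)%N by rewrite ltn_sub2r // (leq_ltn_trans le_ki).
move: (e (Ordinal lt_j)); rewrite !mnmE.
by have -> : tail_ord (Ordinal lt_j) = i by apply: val_inj; rewrite /= subnKC.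
Qed.

Lemma mdeg_tail m : (mdeg (mnm_tail m) <= mdeg m)%N.
Proof.
rewrite !mdegE; under eq_bigr do rewrite mnmE.
rewrite -(big_tail addn (fun i => m i)).
rewrite [leqRHS](bigID (fun i : 'I_n => (k <= i)%N)) /=.
exact: leq_addr.
Qed.

Lemma convergent_tail (K : numFieldType) (g : fps (n - k) K) :
  is_convergent g -> is_convergent (fps_tail g).
Proof.
move=> [e [M [e0 bg]]].
pose e' (i : 'I_n) : K := if insub (i - k)%N is Some j then e j else 1.
have e'0 i : 0 < e' i by rewrite /e'; case: insubP.
have e'_tail j : e' (tail_ord j) = e j. by rewrite /e' /= addKn valK.
pose w (m : 'X_{1..n - k}) := \prod_(j < n - k) e j ^+ m j.
have w0 m : 0 <= w m by apply: prodr_ge0 => j _; rewrite exprn_ge0 ?ltW.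
exists e', M; split=> // d; apply: le_trans (bg d).
have tail_lt (m : 'X_{1..n < d}) : (mdeg (mnm_tail m) < d)%N.
  exact: leq_ltn_trans (mdeg_tail m) (bmdeg m).
pose t (m : 'X_{1..n < d}) := BMultinom (tail_lt m).
pose A := [set m : 'X_{1..n < d} | head_free m].
have t_inj : {in A &, injective t}.
  move=> m1 m2; rewrite !inE => h1 h2 /(congr1 val) /= e12.
  by apply: val_inj; exact: mnm_tail_inj e12.
have -> : \sum_(m : 'X_{1..n < d}) `|fps_tail g m| * \prod_(i < n) e' i ^+ m i =
    \sum_(m in A) `|g (t m)| * w (t m).
  rewrite [RHS]big_mkcond /=; apply: eq_bigr => m _; rewrite inE /fps_tail.
  have [/forallP hm|_] := boolP (head_free m); last by rewrite normr0 mul0r.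
  congr (_ * _); rewrite (bigID (fun i : 'I_n => (k <= i)%N)) /= mulrC.
  rewrite big1 ?mul1r => [|i]; last first.
    by rewrite -ltnNge => lt_ik; move: (hm i); rewrite lt_ik => /eqP ->.
  rewrite (big_tail _ (fun i => e' i ^+ m i)).
  by apply: eq_bigr => j _; rewrite e'_tail mnmE.
rewrite -(big_imset (fun m => `|g (val m)| * w (val m)) t_inj) /=.
rewrite [leRHS](bigID (mem [set t m | m in A])) /= lerDl.
apply: sumr_ge0 => m _; apply: mulr_ge0; [exact: normr_ge0|exact: w0].
Qed.

End Tail.

Section ConvergentRing.
Context (n : nat) (K : numFieldType).

Lemma cps_var_proof i : fps_var K i \in @convergent n K.
Proof. by apply/asboolP; exact: convergent_var. Qed.

Definition cps_var (i : 'I_n) : cps n K := CPS (cps_var_proof i).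

Lemma cps_tail_proof k (g : cps (n - k) K) :
  fps_tail (coef g) \in @convergent n K.
Proof. by apply/asboolP/convergent_tail/asboolP/coef_convergent. Qed.

(* The inclusion of K<x_{k+1}, ..., x_n> in K<x_1, ..., x_n>. *)
Definition cps_tail k (g : cps (n - k) K) : cps n K := CPS (cps_tail_proof g).

(* The maximal ideal of K<x_1, ..., x_n>. *)
Definition cps_max : {pred cps n K} := fun f => coef f 0%MM == 0.

Definition hessian (f : cps n K) : 'M[K]_n :=
  \matrix_(i, j) fps_deriv i (fps_deriv j (coef f)) 0%MM.

(* [phi] is a local automorphism of the K-algebra K<x_1, ..., x_n>. *)
Definition right_equiv (f g : cps n K) : Prop :=
  exists phi : {lrmorphism cps n K -> cps n K},
    [/\ bijective phi, {homo phi : h / h \in cps_max} & phi f = g].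

End ConvergentRing.

(* The [j]-th power of the ideal [I]: the ideal generated by the products of
   [j] elements of [I]. *)
Definition ideal_pow (A : comNzRingType) (I : {pred A}) (j : nat) (f : A) :
    Prop :=
  exists (N : nat) (c : 'I_N -> A) (h : 'I_N -> 'I_j -> A),
    (forall i l, h i l \in I) /\ f = \sum_(i < N) c i * \prod_(l < j) h i l.

Variant base_field := Reals | Complexes.

Definition scalars (R : realType) (b : base_field) : numFieldType :=
  match b with Reals => R | Complexes => R[i] end.

(* The coefficients allowed in front of the squares x_i^2. *)
Definition square_coef (R : realType) (b : base_field) (c : scalars R b) :
    Prop :=
  match b with Reals => c = 1 \/ c = -1 | Complexes => c = 1 end.

(* Main.v *)
From HB Require Import structures.
Require Import Defs.
From mathcomp Require Import all_boot all_order all_algebra.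
From mathcomp Require Import boolp functions reals complex mpoly.
From mathcomp Require Import ring.
Import Order.TTheory GRing.Theory Num.Theory.
Local Open Scope ring_scope.

(** The splitting lemma rests on one fixed point principle ([fixed_point]). An
operator on tuples of power series that determines its output in degree [d] from
the input in degrees below [d] has a formal fixed point, and if it preserves a
ball for the weighted l1 norm on some small polydisc, this fixed point
converges. The principle is applied twice.

The inverse function theorem ([local_bijective]) solves [h = L^-1 (x - G h)]: a
local morphism is bijective as soon as its Jacobian matrix is invertible. Local
morphisms are determined by the images of the variables ([local_ext]) and every
choice of convergent images without constant term occurs ([local_of_vars]).

Existence: a linear substitution diagonalises the quadratic part
([symmetric_diagonalize]), so [f] becomes [q + c] with
[q = a_1 x_1^2 + ... + a_k x_k^2] and [c] vanishing to order 3. The residual part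
is then reached in one step: one looks for [u] such that [x_i |-> x_i + u_i],
[i <= k], removes from [q + c] all further terms that involve
[x_1, ..., x_k]. As
[q (x + u) = q + 2 sum a_i x_i u_i + q (u)], dividing [q (u) + c (x + u)] by
[x_1, ..., x_k] gives an equation for [u] of fixed point type ([splitting]).

Uniqueness: let the automorphism [phi] send [q + g] to [q' + g'], and let [phi_i]
be the image of [x_i]. Comparison of the quadratic parts shows that the linear
parts of [phi_1, ..., phi_k] involve only [x_1, ..., x_k] and form an isometry
[A] from [q'] to [q]. By the inverse function theorem the equations
[phi_i (x) = - (A x)_i], [i <= k], which have linear part [2 A x = 0], can be
solved for [x_1, ..., x_k] in terms of the other variables. On this solution
[q (phi)] and [q'] agree, so [g] composed with the remaining components of [phi]
equals [g'], and this composition is an automorphism since its Jacobian matrix is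
the lower right block of that of [phi] ([residual_unique]). *)

Set Implicit Arguments.
Unset Strict Implicit.
Unset Printing Implicit Defensive.

(** * Order of vanishing at the origin *)

Section Order.
Context (n : nat) (K : comNzRingType).
Implicit Types (f g w : fps n K) (m : 'X_{1..n}) (d e : nat).

Definition ord_ge d f := forall m, (mdeg m < d)%N -> f m = 0.

Lemma fps_oppE f m : (- f) m = - f m. Proof. by []. Qed.

Lemma fps_subE f g m : (f - g) m = f m - g m. Proof. by []. Qed.

Lemma fps_sumE (I : Type) (r : seq I) (P : pred I) (F : I -> fps n K) m :
  (\sum_(i <- r | P i) F i) m = \sum_(i <- r | P i) F i m.
Proof. by elim/big_rec2: _ => // i y1 y2 _ <-. Qed.

Lemma ord_ge0 f : ord_ge 0 f. Proof. by []. Qed.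

Lemma ord_ge_zero d : ord_ge d (0 : fps n K). Proof. by []. Qed.

Lemma ord_geW d e f : (e <= d)%N -> ord_ge d f -> ord_ge e f.
Proof. by move=> ed fd m lt_me; apply: fd; exact: leq_trans lt_me ed. Qed.

Lemma ord_geD d f g : ord_ge d f -> ord_ge d g -> ord_ge d (f + g).
Proof. by move=> fd gd m lt_m; rewrite fps_addE fd // gd // addr0. Qed.

Lemma ord_geN d f : ord_ge d f -> ord_ge d (- f).
Proof. by move=> fd m lt_m; rewrite fps_oppE fd // oppr0. Qed.

Lemma ord_geB d f g : ord_ge d f -> ord_ge d g -> ord_ge d (f - g).
Proof. by move=> fd gd; apply: ord_geD => //; exact: ord_geN. Qed.

Lemma ord_geZ d c f : ord_ge d f -> ord_ge d (c *: f).
Proof. by move=> fd m lt_m; rewrite fps_scaleE fd // mulr0. Qed.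

Lemma ord_ge_sum d (I : Type) (r : seq I) (P : pred I) (F : I -> fps n K) :
  (forall i, P i -> ord_ge d (F i)) -> ord_ge d (\sum_(i <- r | P i) F i).
Proof.
by move=> Fd; apply: big_ind => //; exact: ord_geD.
Qed.

Lemma ord_geM d e f g : ord_ge d f -> ord_ge e g -> ord_ge (d + e) (f * g).
Proof.
move=> fd ge m lt_m; rewrite fps_mulE /fps_mul big1 // => -[k1 k2] /=.
move: (bmnm k1) (bmnm k2) => {}k1 {}k2 /eqP em.
have [lt_d|le_d] := ltnP (mdeg k1) d; first by rewrite fd ?mul0r.
have := congr1 mdeg em; rewrite mdegD => em'.
rewrite [g _]ge ?mulr0 // -(ltn_add2l d); apply: leq_ltn_trans lt_m.
by rewrite em' leq_add2r.
Qed.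

Lemma ord_ge_eq0 f : (forall d, ord_ge d f) -> f = 0.
Proof. by move=> fd; apply/funext => m; apply: (fd (mdeg m).+1). Qed.

Lemma ord_ge1 f : ord_ge 1 f <-> f 0%MM = 0.
Proof.
split=> [->//|f0 m]; first by rewrite mdeg0.
by rewrite ltnS leqn0 mdeg_eq0 => /eqP ->.
Qed.

Lemma fps_oneE m : (1 : fps n K) m = (m == 0%MM)%:R. Proof. by []. Qed.

Lemma fps_algE c m : (c%:A : fps n K) m = c *+ (m == 0%MM).
Proof. by rewrite fps_scaleE fps_oneE mulr_natr. Qed.

Lemma ord_ge_subconst f : ord_ge 1 (f - (f 0%MM)%:A).
Proof. by apply/ord_ge1; rewrite fps_subE fps_algE eqxx subrr. Qed.

Lemma ord_ge1_var i : ord_ge 1 (fps_var K i).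
Proof.
apply/ord_ge1; rewrite /fps_var eq_sym.
by case: eqP => // /(congr1 mdeg); rewrite mdeg1 mdeg0.
Qed.

Lemma ord_ge_prod (I : finType) (F : I -> fps n K) (N : I -> nat) :
  (forall i, ord_ge (N i) (F i)) -> ord_ge (\sum_i N i) (\prod_i F i).
Proof.
by move=> FN; elim/big_rec2: _ => // i d g _ gd; exact: ord_geM.
Qed.

Lemma ord_geX d f N : ord_ge d f -> ord_ge (d * N) (f ^+ N).
Proof.
move=> fd; elim: N => [|N IHN]; first by rewrite muln0.
by rewrite exprS mulnS; exact: ord_geM.
Qed.

Lemma fps_mul_lin f g i : ord_ge 1 f ->
  (f * g) U_(i)%MM = f U_(i)%MM * g 0%MM.
Proof.
move=> f1; have := ord_geM f1 (ord_ge_subconst g) (m := U_(i)%MM).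
rewrite mdeg1 => /(_ isT); rewrite mulrBr fps_subE => /subr0_eq ->.
by rewrite mulrC -scalerAl mul1r fps_scaleE mulrC.
Qed.

Lemma fps_varM_coef i g m :
  (fps_var K i * g) m = if (0 < m i)%N then g (m - U_(i))%MM else 0.
Proof.
rewrite fps_mulE /fps_mul; case: ifP => [m0|m0].
  have le_m : (U_(i) <= m)%MM by rewrite lep1mP -lt0n.
  have d1 : (mdeg U_(i)%MM < (mdeg m).+1)%N.
    by rewrite -(submK le_m) mdegD ltnS leq_addl.
  have d2 : (mdeg (m - U_(i))%MM < (mdeg m).+1)%N.
    by rewrite ltnS mdegB.
  rewrite (bigD1 (BMultinom d1, BMultinom d2)) /=; last by rewrite addmC submK.
  rewrite /fps_var eqxx mul1r big1 ?addr0 // => -[[k1 h1] [k2 h2]] /=.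
  move=> /andP[/eqP em].
  case: (k1 =P U_(i)%MM) => [e1|_]; last by rewrite mul0r.
  rewrite xpair_eqE !bmeqP /= e1 eqxx /= => /eqP[].
  by rewrite em e1 (addmC U_(i)%MM) addmK.
rewrite big1 // => -[k1 k2] /=; move: (bmnm k1) (bmnm k2) => {}k1 {}k2 /eqP em.
rewrite /fps_var; case: eqP => [e1|_].
  by move: m0; rewrite em e1 mnmDE mnmE eqxx.
by rewrite mul0r.
Qed.

End Order.

(** * Division by the variables *)

Section Division.
Context (n : nat) (K : comNzRingType).
Implicit Types (f g w : fps n K) (m : 'X_{1..n}) (i : 'I_n).

(** The division attributes each monomial that involves one of the first [k]
variables to the first of these that occurs in it, so that the quotients and the
remainder partition the coefficients of the dividend and inherit its bounds. *)
Definition fps_quot i w : fps n K :=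
  fun m => if head_free i m then w (m + U_(i))%MM else 0.

Definition fps_rem (k : nat) w : fps n K :=
  fun m => if head_free k m then w m else 0.

Lemma head_freeS i m : head_free i.+1 m = head_free i m && (m i == 0%N).
Proof.
apply/forallP/andP => [h|[/forallP h mi] j].
  split; last by have := h i; rewrite ltnSn.
  by apply/forallP => j; apply/implyP => ji; move: (h j);
    rewrite ltnS (ltnW ji).
rewrite ltnS leq_eqVlt; apply/implyP => /orP[/eqP/val_inj -> //|ji].
by move: (h j); rewrite ji.
Qed.

Lemma head_free0 m : head_free 0 m.
Proof. by apply/forallP. Qed.

Lemma head_free_all m : head_free n m = (m == 0%MM).
Proof.
apply/forallP/eqP => [h|-> i]; last by rewrite mnmE eqxx implybT.
by apply/mnmP => i; move: (h i); rewrite ltn_ord mnmE => /eqP.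
Qed.

Lemma head_free_subU i m : (0 < m i)%N ->
  head_free i (m - U_(i))%MM = head_free i m.
Proof.
move=> mi; apply: eq_forallb => j; case: ltnP => //= ji.
rewrite mnmBE mnmE; case: (i =P j) => [e|_]; last by rewrite subn0.
by rewrite e ltnn in ji.
Qed.

Lemma fps_remS i w : fps_rem i w = fps_var K i * fps_quot i w + fps_rem i.+1 w.
Proof.
apply/funext => m; rewrite fps_addE fps_varM_coef /fps_rem /fps_quot head_freeS.
have [mi|mi] := ltnP 0 (m i).
  rewrite head_free_subU // submK; last by rewrite lep1mP -lt0n.
  by rewrite [m i == _](gtn_eqF mi) andbF addr0.
by move: mi; rewrite leqn0 => ->; rewrite andbT add0r.
Qed.

Lemma fps_division k w : (k <= n)%N ->
  w = \sum_(i < n | (i < k)%N) fps_var K i * fps_quot i w + fps_rem k w.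
Proof.
elim: k => [|k IHk] lt_kn.
  rewrite big_pred0 // add0r; apply/funext => m.
  by rewrite /fps_rem head_free0.
rewrite [LHS](IHk (ltnW lt_kn))
  -[k in fps_rem k](_ : nat_of_ord (Ordinal lt_kn) = k) //.
rewrite fps_remS addrA; congr (_ + _).
rewrite [RHS](bigD1 (Ordinal lt_kn)) //= addrC; congr (_ + _).
by apply: eq_bigl => i; rewrite ltnS ltn_neqAle andbC -val_eqE.
Qed.

Lemma fps_rem_all w : fps_rem n w = (w 0%MM)%:A.
Proof.
apply/funext => m; rewrite /fps_rem head_free_all fps_algE.
by case: eqP => // ->.
Qed.

(** The case [k = n], Hadamard's lemma: it turns statements about all series into
inductions on the order of vanishing. *)
Lemma fps_hadamard w :
  w = \sum_(i < n) fps_var K i * fps_quot i w + (w 0%MM)%:A.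
Proof.
rewrite -fps_rem_all [LHS](fps_division w (leqnn n)); congr (_ + _).
by apply: eq_bigl => i; rewrite ltn_ord.
Qed.

Lemma fps_quot0 i w : fps_quot i w 0%MM = w U_(i)%MM.
Proof.
rewrite /fps_quot add0m ifT //; apply/forallP => j; rewrite mnmE.
by rewrite eqxx implybT.
Qed.

Lemma ord_ge_quot d i w : ord_ge d.+1 w -> ord_ge d (fps_quot i w).
Proof.
move=> wd m lt_m; rewrite /fps_quot wd ?if_same // mdegD mdeg1 addn1.
by rewrite ltnS.
Qed.

Lemma ord_ge_rem d k w : ord_ge d w -> ord_ge d (fps_rem k w).
Proof. by move=> wd m lt_m; rewrite /fps_rem wd ?if_same. Qed.

Lemma fps_quotB i w w' : fps_quot i (w - w') = fps_quot i w - fps_quot i w'.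
Proof.
by apply/funext => m; rewrite fps_subE /fps_quot; case: ifP; rewrite ?subr0.
Qed.

End Division.

(** * Substitution of power series *)

Section Substitution.
Context (n p : nat) (K : comNzRingType).
Implicit Types (f g : fps n K) (h : 'I_n -> fps p K) (P Q : {mpoly K[n]}).

Local Notation eval h := (mmap (in_alg (fps p K)) h).

(** Only the terms of degree at most [mdeg m] of [f] can contribute to the
coefficient at [m] when the [h i] have no constant term; without that
assumption the value is meaningless. *)
Definition fps_subst h f : fps p K :=
  fun m => eval h (fps_trunc (mdeg m).+1 f) m.

Lemma ord_ge_mmap1 h k : (forall i, ord_ge 1 (h i)) ->
  ord_ge (mdeg k) (mmap1 h k).
Proof.
move=> h1; rewrite mdegE; apply: ord_ge_prod => i.
by rewrite -[X in ord_ge X]mul1n; exact: ord_geX.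
Qed.

Lemma ord_ge_eval d h P : (forall i, ord_ge 1 (h i)) ->
  (forall k, (mdeg k < d)%N -> P@_k = 0) -> ord_ge d (eval h P).
Proof.
move=> h1 Pd; apply: ord_ge_sum => k _; have [/Pd ->|le_d] := ltnP (mdeg k) d.
  by rewrite rmorph0 mul0r.
rewrite -scalerAl mul1r; apply: ord_geZ; apply: ord_geW le_d _.
exact: ord_ge_mmap1.
Qed.

Lemma fps_subst_eval d h f P m : (forall i, ord_ge 1 (h i)) ->
  (forall k, (mdeg k < d)%N -> P@_k = f k) -> (mdeg m < d)%N ->
  fps_subst h f m = eval h P m.
Proof.
move=> h1 Pf lt_md; apply/eqP; rewrite -subr_eq0 /fps_subst -fps_subE -rmorphB.
apply/eqP/(@ord_ge_eval (mdeg m).+1) => // k lt_k.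
by rewrite mcoeffB fps_trunc_coef // Pf ?subrr // (leq_trans lt_k).
Qed.

Lemma fps_subst_sum d h f m : (forall i, ord_ge 1 (h i)) -> (mdeg m < d)%N ->
  fps_subst h f m = \sum_(k : 'X_{1..n < d}) f k * mmap1 h k m.
Proof.
move=> h1 lt_md.
rewrite (@fps_subst_eval d h f (fps_trunc d f)) // => [|k];
  last exact: fps_trunc_coef.
rewrite raddf_sum fps_sumE; apply: eq_bigr => k _.
by rewrite /= mmapZ mmapX -scalerAl mul1r fps_scaleE.
Qed.

Lemma fps_subst_linear h : (forall i, ord_ge 1 (h i)) -> linear (fps_subst h).
Proof.
move=> h1 c f g; apply/funext => m.
rewrite fps_addE fps_scaleE !(@fps_subst_sum (mdeg m).+1) // mulr_sumr
  -big_split.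
by apply: eq_bigr => k _; rewrite /= fps_addE fps_scaleE mulrDl mulrA.
Qed.

Lemma fps_subst_monoid h : (forall i, ord_ge 1 (h i)) ->
  monoid_morphism (fps_subst h).
Proof.
move=> h1; split=> [|f g]; apply/funext => m.
  rewrite (@fps_subst_eval (mdeg m).+1 h 1 1) ?rmorph1 // => k _.
  by rewrite mcoeff1.
set d := (mdeg m).+1; pose t := @fps_trunc n K d.
have t_close u : ord_ge d (eval h (t u) - fps_subst h u).
  move=> k lt_k; rewrite fps_subE (@fps_subst_eval d h u (t u)) ?subrr // => k'.
  exact: fps_trunc_coef.
rewrite (@fps_subst_eval d h (f * g) (t f * t g)) // => [|k lt_k]; last first.
  by rewrite fps_mulE (@fps_mul_trunc _ _ d).
rewrite rmorphM /=; apply/eqP; rewrite -subr_eq0 -fps_subE; apply/eqP.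
set F := eval h (t f); set G := eval h (t g).
have -> : F * G - fps_subst h f * fps_subst h g =
    (F - fps_subst h f) * G + fps_subst h f * (G - fps_subst h g).
  by rewrite mulrBl mulrBr addrA subrK.
apply: (@ord_geD _ _ d) => //.
  by rewrite -[X in ord_ge X]addn0; apply: ord_geM => //; exact: t_close.
by rewrite -[X in ord_ge X]add0n; apply: ord_geM => //; exact: t_close.
Qed.

Lemma fps_subst_var h i : (forall i, ord_ge 1 (h i)) ->
  fps_subst h (fps_var K i) = h i.
Proof.
move=> h1; apply/funext => m.
rewrite (@fps_subst_eval (mdeg m).+1 h _ 'X_i) //; last first.
  by move=> k _; rewrite mcoeffX eq_sym.
by rewrite mmapX mmap1U.
Qed.

Lemma ord_ge_subst h d f : (forall i, ord_ge 1 (h i)) -> ord_ge d f ->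
  ord_ge d (fps_subst h f).
Proof.
move=> h1 fd m lt_m; rewrite (@fps_subst_eval d h f 0) // => [|k lt_k].
  by rewrite rmorph0.
by rewrite mcoeff0 fd.
Qed.

Section Close.
Context (h h' : 'I_n -> fps p K) (d : nat).
Hypotheses (h1 : forall i, ord_ge 1 (h i)) (h'1 : forall i, ord_ge 1 (h' i)).
Hypothesis hh' : forall i, ord_ge d (h i - h' i).

(** Peeling one variable [x_i] off the monomial, [h i * u - h' i * u'] equals
[(h i - h' i) * u + h' i * (u - u')]: each of the other [e] factors contributes
one to the order. *)
Lemma ord_ge_mmap1_sub e k : mdeg k = e.+1 ->
  ord_ge (d + e) (mmap1 h k - mmap1 h' k).
Proof.
elim: e k => [|e IHe] k dk.
  have /mdeg1P[i /eqP ->] : mdeg k == 1%N by rewrite dk.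
  by rewrite !mmap1U addn0.
have [i ki] : exists i, k i != 0%N.
  apply/existsP; rewrite -negb_forall; apply/negP => /forallP k0.
  by move: dk; rewrite mdegE big1 // => i _; apply/eqP.
have kE : k = (U_(i) + (k - U_(i)))%MM by rewrite addmC submK // lep1mP.
have dk' : mdeg (k - U_(i))%MM = e.+1.
  by move: dk; rewrite {1}kE mdegD mdeg1 add1n => -[].
rewrite kE !commr_mmap1_M; [|by move=> *; exact: mulrC..].
rewrite !mmap1U; set u := mmap1 h _; set u' := mmap1 h' _.
have -> : h i * u - h' i * u' = (h i - h' i) * u + h' i * (u - u').
  by rewrite mulrBl mulrBr addrA subrK.
apply: ord_geD; last first.
  by rewrite addnS -add1n; apply: ord_geM => //; exact: IHe.
by apply: ord_geM => //; rewrite -dk'; exact: ord_ge_mmap1.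
Qed.

(** The gain of [e] in the order is what makes the operators solved below
contractions for the degree filtration. *)
Lemma ord_ge_subst_sub e f : ord_ge e.+1 f ->
  ord_ge (d + e) (fps_subst h f - fps_subst h' f).
Proof.
move=> fe m lt_m; rewrite fps_subE !(@fps_subst_sum (mdeg m).+1) // -sumrB.
apply: big1 => -[k lt_k] _ /=; rewrite -mulrBr -fps_subE.
have [/fe ->|] := ltnP (mdeg k) e.+1; first by rewrite mul0r.
case dk: (mdeg k) => [//|e']; rewrite ltnS => le_ee'.
rewrite (ord_ge_mmap1_sub dk) ?mulr0 //.
by apply: leq_trans lt_m _; rewrite leq_add2l.
Qed.

End Close.
End Substitution.

(** * Weighted l1 norms *)

Section Norm.
Context (n : nat) (K : numFieldType).
Implicit Types (f g : fps n K) (r s M N : K).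

(** [norm_le r f M] bounds by [M] the weighted l1 norm on the polydisc of
equal radii [r]. A bound on all partial sums needs no supremum, hence makes
sense over any numeric field. *)
Definition norm_le r f M :=
  forall d, \sum_(m : 'X_{1..n < d}) `|f m| * r ^+ mdeg m <= M.

Lemma polydisc_norm_le r f M : polydisc_bounded f (fun=> r) M <-> norm_le r f M.
Proof.
have E (m : 'X_{1..n}) : \prod_(i < n) r ^+ m i = r ^+ mdeg m.
  by rewrite mdegE; elim/big_rec2: _ => // i y1 y2 _ ->; rewrite exprD.
by split=> h d; [under eq_bigr do rewrite -E|under eq_bigr do rewrite E].
Qed.

Lemma norm_le_ge0 r f M : norm_le r f M -> 0 <= M.
Proof. by move=> /(_ 0%N); rewrite big1 // => m; have := bmdeg m. Qed.

Lemma norm_leW r f M N : M <= N -> norm_le r f M -> norm_le r f N.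
Proof. by move=> MN fM d; exact: le_trans (fM d) MN. Qed.

Lemma norm_le_zero r M : 0 <= M -> norm_le r (0 : fps n K) M.
Proof. by move=> M0 d; rewrite big1 // => m _; rewrite normr0 mul0r. Qed.

Lemma norm_leD r f g M N : 0 <= r ->
  norm_le r f M -> norm_le r g N -> norm_le r (f + g) (M + N).
Proof.
move=> r0 fM gN d; apply: le_trans (lerD (fM d) (gN d)).
rewrite -big_split; apply: ler_sum => m _ /=; rewrite -mulrDl.
by apply: ler_wpM2r; [exact: exprn_ge0|exact: ler_normD].
Qed.

Lemma norm_leZ r c f M : norm_le r f M -> norm_le r (c *: f) (`|c| * M).
Proof.
move=> fM d; apply: le_trans (ler_wpM2l (normr_ge0 c) (fM d)).
rewrite mulr_sumr; apply: ler_sum => m _.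
by rewrite fps_scaleE normrM mulrA.
Qed.

Lemma norm_leN r f M : norm_le r f M -> norm_le r (- f) M.
Proof. by move=> fM d; under eq_bigr do rewrite fps_oppE normrN. Qed.

Lemma norm_leB r f g M N : 0 <= r ->
  norm_le r f M -> norm_le r g N -> norm_le r (f - g) (M + N).
Proof. by move=> r0 fM /norm_leN gN; exact: norm_leD. Qed.

Lemma norm_le_sum r (I : finType) (P : pred I) (F : I -> fps n K) (M : I -> K) :
  0 <= r -> (forall i, P i -> norm_le r (F i) (M i)) ->
  norm_le r (\sum_(i | P i) F i) (\sum_(i | P i) M i).
Proof.
move=> r0 FM; apply: (big_rec2 (norm_le r)); first exact: norm_le_zero.
by move=> i x y Pi xy; apply: norm_leD => //; exact: FM.
Qed.

Lemma norm_leM r f g M N : 0 <= r ->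
  norm_le r f M -> norm_le r g N -> norm_le r (f * g) (M * N).
Proof.
move=> r0 fM gN d; have w0 (m : 'X_{1..n}) :
  0 <= r ^+ mdeg m by exact: exprn_ge0.
have le_MN : (\sum_(m : 'X_{1..n < d}) `|f m| * r ^+ mdeg m) *
             (\sum_(m : 'X_{1..n < d}) `|g m| * r ^+ mdeg m) <= M * N.
  by apply: ler_pM; [apply: sumr_ge0 => m _; rewrite mulr_ge0..| |].
apply: le_trans le_MN; rewrite big_distrlr /= pair_big /=.
apply: (@le_trans _ _ (\sum_(m : 'X_{1..n < d})
   \sum_(k : 'X_{1..n < d, d} | val m == (k.1 + k.2)%MM)
     (`|f k.1| * r ^+ mdeg k.1) * (`|g k.2| * r ^+ mdeg k.2))).
  apply: ler_sum => m _; rewrite fps_mulE (fps_mul_bound _ _ (bmdeg m)).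
  rewrite -[r ^+ _]ger0_norm // -normrM mulr_suml.
  apply: le_trans (ler_norm_sum _ _ _) _; apply: ler_sum => k /eqP ->.
  by rewrite mdegD exprD !normrM !(ger0_norm (w0 _)) mulrACA.
rewrite (exchange_big_dep predT) //=; apply: ler_sum => k _.
set t := _ * _; have t0 : 0 <= t by rewrite !mulr_ge0.
have [lt_d|le_d] := ltnP (mdeg (k.1 + k.2)%MM) d.
  by rewrite (big_pred1 (BMultinom lt_d)) // => m; rewrite /= bmeqP.
rewrite big1 // => m /eqP em.
by move: (bmdeg m); rewrite em ltnNge le_d.
Qed.

Lemma norm_le_delta r (m0 : 'X_{1..n}) : 0 <= r ->
  norm_le r (fps_delta K m0) (r ^+ mdeg m0).
Proof.
move=> r0 d; rewrite /fps_delta; have [lt_d|le_d] := ltnP (mdeg m0) d.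
  rewrite (bigD1 (BMultinom lt_d)) //= eqxx normr1 mul1r big1 ?addr0 // => m.
  by rewrite bmeqP /= => /negbTE->; rewrite normr0 mul0r.
rewrite big1 ?exprn_ge0 // => m _; case: eqP => [em|_];
  last by rewrite normr0 mul0r.
by move: (bmdeg m); rewrite em ltnNge le_d.
Qed.

Lemma norm_le_one r : 0 <= r -> norm_le r (1 : fps n K) 1.
Proof. by move=> r0; have := @norm_le_delta r 0%MM r0; rewrite mdeg0. Qed.

Lemma norm_le_var r i : 0 <= r -> norm_le r (fps_var K i : fps n K) r.
Proof. by move=> r0; have := @norm_le_delta r U_(i)%MM r0; rewrite mdeg1. Qed.

Lemma norm_le_prod r (I : finType) (F : I -> fps n K) (M : I -> K) :
  0 <= r -> (forall i, norm_le r (F i) (M i)) ->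
  norm_le r (\prod_i F i) (\prod_i M i).
Proof.
move=> r0 FM; apply: (big_rec2 (norm_le r)); first exact: norm_le_one.
by move=> i x y Pi xy; apply: norm_leM.
Qed.

Lemma norm_leX r f M (N : nat) : 0 <= r -> norm_le r f M ->
  norm_le r (f ^+ N) (M ^+ N).
Proof.
move=> r0 fM; elim: N => [|N IHN]; first exact: norm_le_one.
by rewrite !exprS; exact: norm_leM.
Qed.

Lemma norm_le_rem r k f M : 0 <= r -> norm_le r f M ->
  norm_le r (fps_rem k f) M.
Proof.
move=> r0 fM d; apply: le_trans (fM d); apply: ler_sum => m _.
by apply: ler_wpM2r; rewrite ?exprn_ge0 // /fps_rem; case: ifP; rewrite ?normr0.
Qed.

Lemma norm_le_quot r i f M : 0 < r -> norm_le r f M ->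
  norm_le r (fps_quot i f) (M / r).
Proof.
move=> r0 fM d; rewrite ler_pdivlMr // mulr_suml.
have t0 (m : 'X_{1..n}) : 0 <= `|f m| * r ^+ mdeg m.
  by rewrite mulr_ge0 // exprn_ge0 // ltW.
apply: le_trans (fM d.+1).
have lt_U (m : 'X_{1..n < d}) : (mdeg (m + U_(i))%MM < d.+1)%N.
  by rewrite mdegD mdeg1 addn1 ltnS bmdeg.
pose t (m : 'X_{1..n < d}) := BMultinom (lt_U m).
have t_inj : injective t.
  move=> m1 m2 /(congr1 val) /= /(congr1 (fun m : 'X_{1..n} => (m - U_(i))%MM)).
  by rewrite !addmK; exact: val_inj.
apply: (@le_trans _ _ (\sum_(m in [set t m | m in setT]) `|f m| * r ^+ mdeg m)).
  rewrite big_imset /=; last by move=> ? ? _ _; exact: t_inj.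
  rewrite [leRHS](eq_bigl xpredT) => [|m]; last by rewrite inE.
  apply: ler_sum => m _.
  rewrite -mulrA -exprSr mdegD mdeg1 addn1 ler_wpM2r ?exprn_ge0 ?(ltW r0) //.
  by rewrite /fps_quot; case: ifP; rewrite ?normr0.
rewrite [leRHS](bigID (mem [set t m | m in setT])) /= lerDl.
by apply: sumr_ge0.
Qed.

(** Vanishing to order [e] makes the norm decrease like the [e]-th power of the
radius: the source of all smallness in the fixed point arguments. *)
Lemma norm_le_shrink e r s f M : 0 <= r <= s -> 0 < s -> ord_ge e f ->
  norm_le s f M -> norm_le r f ((r / s) ^+ e * M).
Proof.
move=> /andP[r0 rs] s0 fe fM d.
have q0 : 0 <= r / s by rewrite divr_ge0 // ltW.
apply: le_trans (ler_wpM2l (exprn_ge0 e q0) (fM d)).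
rewrite mulr_sumr; apply: ler_sum => m _.
have [/fe ->|le_e] := ltnP (mdeg m) e; first by rewrite normr0 !(mul0r, mulr0).
rewrite mulrCA ler_wpM2l //.
have -> : r ^+ mdeg m = (r / s) ^+ mdeg m * s ^+ mdeg m.
  by rewrite -exprMn divfK // gt_eqF.
rewrite ler_wpM2r ?exprn_ge0 ?(ltW s0) // ler_wiXn2l //.
by rewrite ler_pdivrMr // mul1r.
Qed.

End Norm.

Section NormSubst.
Context (n p : nat) (K : numFieldType).

(** By the triangle inequality and multiplicativity of the norm, the majorant
of [f] evaluated at [s] bounds the composite. *)
Lemma norm_le_subst (h : 'I_n -> fps p K) (f : fps n K) r s M : 0 <= r ->
  0 <= s ->
  (forall i, ord_ge 1 (h i)) -> (forall i, norm_le r (h i) s) ->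
  norm_le s f M -> norm_le r (fps_subst h f) M.
Proof.
move=> r0 s0 h1 hs fM d; apply: le_trans (fM d).
apply: (@le_trans _ _ (\sum_(m : 'X_{1..p < d}) \sum_(k : 'X_{1..n < d})
    `|f k| * (`|mmap1 h k m| * r ^+ mdeg m))).
  apply: ler_sum => m _; rewrite (@fps_subst_sum _ _ _ d) ?bmdeg //.
  rewrite -[r ^+ _]ger0_norm ?exprn_ge0 // -normrM mulr_suml.
  apply: le_trans (ler_norm_sum _ _ _) _; apply: ler_sum => k _.
  by rewrite !normrM mulrA.
rewrite exchange_big; apply: ler_sum => k _; rewrite -mulr_sumr.
apply: ler_wpM2l => //.
have -> : s ^+ mdeg k = \prod_(i < n) s ^+ k i.
  by rewrite mdegE; elim/big_rec2: _ => // i y1 y2 _ <-; rewrite exprD.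
by apply: norm_le_prod => // i; exact: norm_leX.
Qed.

Lemma is_convergentP (f : fps n K) :
  is_convergent f <-> exists r M, 0 < r /\ norm_le r f M.
Proof.
split=> [[e [M [e0 fM]]]|[r [M [r0 fM]]]]; last first.
  by exists (fun=> r), M; split=> //; apply/polydisc_norm_le.
pose S := \sum_i (e i)^-1; have S0 : 0 <= S.
  by apply: sumr_ge0 => i _; rewrite invr_ge0 ltW.
have S1 : 0 < 1 + S by rewrite ltr_wpDr.
exists (1 + S)^-1, M; rewrite invr_gt0; split=> //.
apply/polydisc_norm_le; apply: polydisc_bounded_shrink fM => i.
rewrite invr_ge0 ltW //= -[e i]invrK lef_pV2 ?posrE ?invr_gt0 //.
rewrite /S (bigD1 i) //= addrCA lerDl addr_ge0 //.
by apply: sumr_ge0 => j _; rewrite invr_ge0 ltW.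
Qed.

Lemma convergent_family (I : finType) (F : I -> fps n K) :
  (forall i, is_convergent (F i)) ->
  exists r M, [/\ 0 < r, 0 <= M & forall i, norm_le r (F i) M].
Proof.
move=> Fc.
have /choice[e /choice[N eN]] i := (is_convergentP (F i)).1 (Fc i).
pose S := \sum_i (e i)^-1; have S0 : 0 <= S.
  by apply: sumr_ge0 => i _; rewrite invr_ge0 ltW //; have [] := eN i.
have S1 : 0 < 1 + S by rewrite ltr_wpDr.
exists (1 + S)^-1, (\sum_i N i); split; first by rewrite invr_gt0.
  by apply: sumr_ge0 => i _; have [_ /norm_le_ge0] := eN i.
move=> i; have [ei0 FN] := eN i.
have le_r : 0 <= (1 + S)^-1 <= e i.
  rewrite invr_ge0 ltW //= -[e i]invrK lef_pV2 ?posrE ?invr_gt0 //.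
  rewrite /S (bigD1 i) //= addrCA lerDl addr_ge0 //.
  by apply: sumr_ge0 => j _; rewrite invr_ge0 ltW //; have [] := eN j.
apply: norm_leW (norm_le_shrink le_r ei0 (@ord_ge0 _ _ _) FN).
rewrite expr0 mul1r (bigD1 i) //= lerDl.
by apply: sumr_ge0 => j _; have [_ /norm_le_ge0] := eN j.
Qed.

(** Over the complex numbers the order is partial and there is no minimum to
take, whence the explicit radius [e / (1 + A * e)]. *)
Lemma small_radius (e A : K) : 0 < e -> 0 <= A ->
  exists r, [/\ 0 < r, r <= e & A * r <= 1].
Proof.
move=> e0 A0; have Ae : 0 <= A * e by rewrite mulr_ge0 // ltW.
have D0 : 0 < 1 + A * e by rewrite ltr_wpDr.
exists (e / (1 + A * e)); split; first by rewrite divr_gt0.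
  by rewrite ler_pdivrMr // ler_peMr ?(ltW e0) // lerDl.
by rewrite mulrA ler_pdivrMr // mul1r lerDr.
Qed.

End NormSubst.

(** * Local morphisms of convergent power series *)

Section MorphismOf.
Context (K : comNzRingType) (A B : algType K) (F : A -> B).
Context (F_linear : linear F) (F_monoid : monoid_morphism F).

Let F' : A -> B := F.
HB.instance Definition _ := GRing.isLinear.Build K A B _ F' F_linear.
HB.instance Definition _ := GRing.isMonoidMorphism.Build A B F' F_monoid.

(** A bare function is packed as a bundled morphism through the alias [F'],
which carries the instances. *)
Lemma lrmorphism_of : exists phi : {lrmorphism A -> B}, phi =1 F.
Proof. by exists F'. Qed.

End MorphismOf.

Lemma lrmorphism_inv (K : comNzRingType) (A B : algType K)
  (phi : {lrmorphism A -> B}) :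
  bijective phi ->
  exists psi : {lrmorphism B -> A}, cancel phi psi /\ cancel psi phi.
Proof.
case=> G phiK GK; have GL : linear G := can2_linear phiK GK.
have GM : monoid_morphism G := can2_monoid_morphism phiK GK.
have [psi psiE] := lrmorphism_of GL GM.
by exists psi; split=> x; rewrite psiE.
Qed.

Section Cps.
Context (n : nat) (K : numFieldType).
Implicit Types (f g h : cps n K) (m : 'X_{1..n}).

Lemma cps_inj : injective (@coef n K). Proof. exact: val_inj. Qed.

Lemma cpsDE f g : coef (f + g) = coef f + coef g. Proof. by []. Qed.
Lemma cpsBE f g : coef (f - g) = coef f - coef g. Proof. by []. Qed.
Lemma cpsME f g : coef (f * g) = coef f * coef g. Proof. by []. Qed.
Lemma cpsZE c f : coef (c *: f) = c *: coef f. Proof. by []. Qed.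
Lemma cps_algE c : coef (c%:A : cps n K) = c%:A. Proof. by []. Qed.
Lemma coef_var (i : 'I_n) : coef (cps_var K i) = fps_var K i. Proof. by []. Qed.

Lemma cps_sumE (I : Type) (r : seq I) (P : pred I) (F : I -> cps n K) :
  coef (\sum_(i <- r | P i) F i) = \sum_(i <- r | P i) coef (F i).
Proof. by elim/big_rec2: _ => // i y1 y2 _ <-. Qed.

Lemma is_convergent_coef f : is_convergent (coef f).
Proof. by apply/asboolP/coef_convergent. Qed.

Lemma cps_of_convergent (F : fps n K) : is_convergent F ->
  exists f : cps n K, coef f = F.
Proof. by move=> /asboolP Fc; exists (CPS Fc). Qed.

Lemma cps_maxP h : (h \in @cps_max n K) <-> ord_ge 1 (coef h).
Proof. by rewrite ord_ge1; split=> /eqP. Qed.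

Lemma cps_max_var i : cps_var K i \in @cps_max n K.
Proof. by apply/cps_maxP; exact: ord_ge1_var. Qed.

Lemma convergent_quot i (F : fps n K) : is_convergent F ->
  is_convergent (fps_quot i F).
Proof.
move=> /is_convergentP[r [M [r0 FM]]]; apply/is_convergentP; exists r, (M / r).
by split=> //; exact: norm_le_quot.
Qed.

Lemma cps_quot_proof i f : fps_quot i (coef f) \in @convergent n K.
Proof. by apply/asboolP/convergent_quot/is_convergent_coef. Qed.

Definition cps_quot i f : cps n K := CPS (cps_quot_proof i f).

Lemma coef_quot i f : coef (cps_quot i f) = fps_quot i (coef f).
Proof. by []. Qed.

Lemma cps_hadamard f :
  f = \sum_(i < n) cps_var K i * cps_quot i f + (coef f 0%MM)%:A.
Proof.
apply: cps_inj; rewrite cpsDE cps_algE cps_sumE.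
exact: fps_hadamard.
Qed.

End Cps.

Section Local.
Context (K : numFieldType).

Definition is_local n p (phi : cps n K -> cps p K) :=
  forall h, h \in @cps_max n K -> phi h \in @cps_max p K.

Definition jacobian n p (phi : cps n K -> cps p K) : 'M[K]_(n, p) :=
  \matrix_(i, j) coef (phi (cps_var K i)) U_(j)%MM.

Section One.
Context (n p : nat) (phi : {lrmorphism cps n K -> cps p K})
  (phi_local : is_local phi).

Lemma local_var i : ord_ge 1 (coef (phi (cps_var K i))).
Proof. by apply/cps_maxP/phi_local/cps_max_var. Qed.

Lemma lrmorph_alg c : phi c%:A = c%:A.
Proof. by rewrite linearZ /= rmorph1. Qed.

Lemma lrmorph_hadamard f :
  phi f = \sum_(i < n) phi (cps_var K i) * phi (cps_quot i f) +
    (coef f 0%MM)%:A.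
Proof.
rewrite {1}[f]cps_hadamard rmorphD rmorph_sum /= lrmorph_alg; congr (_ + _).
by apply: eq_bigr => i _; rewrite rmorphM.
Qed.

Lemma local_ord d f : ord_ge d (coef f) -> ord_ge d (coef (phi f)).
Proof.
elim: d f => [//|d IHd] f fd.
have f0 : coef f 0%MM = 0 by rewrite fd // mdeg0.
rewrite lrmorph_hadamard f0 scale0r addr0 cps_sumE; apply: ord_ge_sum => i _.
rewrite cpsME -[d.+1]add1n; apply: ord_geM; first exact: local_var.
by apply/IHd/ord_ge_quot.
Qed.

Lemma local_at0 f : coef (phi f) 0%MM = coef f 0%MM.
Proof.
rewrite lrmorph_hadamard cpsDE cps_sumE fps_addE cps_algE fps_algE eqxx.
rewrite (@ord_ge_sum _ _ 1) ?mdeg0 ?add0r // => i _.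
by rewrite cpsME -[1%N]addn0; apply: ord_geM => //; exact: local_var.
Qed.

Lemma local_lin f j :
  coef (phi f) U_(j)%MM = \sum_i coef f U_(i)%MM * jacobian phi i j.
Proof.
rewrite lrmorph_hadamard cpsDE cps_sumE fps_addE cps_algE fps_algE mnm1_eq0
  addr0.
rewrite fps_sumE; apply: eq_bigr => i _; rewrite cpsME fps_mul_lin;
  last exact: local_var.
by rewrite local_at0 coef_quot fps_quot0 mulrC mxE.
Qed.

End One.

(** By Hadamard's lemma the difference of the two morphisms vanishes to every
order. *)
Lemma local_ext n p (phi psi : {lrmorphism cps n K -> cps p K}) :
  is_local phi -> is_local psi ->
  (forall i, phi (cps_var K i) = psi (cps_var K i)) -> phi =1 psi.
Proof.
move=> phi1 psi1 e f; apply: cps_inj; apply/eqP; rewrite -subr_eq0; apply/eqP.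
apply: ord_ge_eq0 => d; elim: d f => [//|d IHd] f.
rewrite !lrmorph_hadamard // !cpsDE opprD addrACA subrr addr0 !cps_sumE -sumrB.
apply: ord_ge_sum => i _; rewrite -e !cpsME -mulrBr -[d.+1]add1n.
by apply: ord_geM; [exact: local_var|exact: IHd].
Qed.

Lemma jacobian_comp n p q (phi : {lrmorphism cps n K -> cps p K})
    (psi : {lrmorphism cps p K -> cps q K}) : is_local phi -> is_local psi ->
  jacobian (psi \o phi) = jacobian phi *m jacobian psi.
Proof.
move=> phi1 psi1; apply/matrixP => i j; rewrite !mxE /= local_lin //.
by apply: eq_bigr => l _; rewrite !mxE.
Qed.

Lemma jacobian_id n : jacobian (@idfun (cps n K)) = 1%:M.
Proof.
apply/matrixP => i j; rewrite !mxE /= /fps_var.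
by rewrite eq_mnm1 eq_sym.
Qed.

Lemma eq_jacobian n p (phi psi : cps n K -> cps p K) :
  phi =1 psi -> jacobian phi = jacobian psi.
Proof. by move=> e; apply/matrixP => i j; rewrite !mxE e. Qed.

Lemma local_comp n p q (phi : cps n K -> cps p K) (psi : cps p K -> cps q K) :
  is_local phi -> is_local psi -> is_local (psi \o phi).
Proof. by move=> phi1 psi1 h /phi1/psi1. Qed.

Lemma local_inv n p (phi : {lrmorphism cps n K -> cps p K})
  (psi : cps p K -> cps n K) :
  is_local phi -> cancel psi phi -> is_local psi.
Proof.
move=> phi1 psiK h; rewrite -{1}[h]psiK => hm; apply/cps_maxP/ord_ge1.
by rewrite -(local_at0 phi1); apply/ord_ge1/cps_maxP.
Qed.

Lemma convergent_subst n p (h : 'I_n -> fps p K) (f : fps n K) :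
  (forall i, is_convergent (h i)) -> (forall i, ord_ge 1 (h i)) ->
  is_convergent f -> is_convergent (fps_subst h f).
Proof.
move=> hc h1 /is_convergentP[e [M [e0 fM]]].
have [r0 [N [r0_gt0 N0 hN]]] := convergent_family hc.
have [] := @small_radius K r0 (N / (r0 * e)) r0_gt0.
  by rewrite divr_ge0 // mulr_ge0 // ltW.
move=> r [r_gt0 rr0 rN]; apply/is_convergentP; exists r, M; split=> //.
apply: (norm_le_subst (s := e)) => //; try exact: ltW.
move=> i; have rr : 0 <= r <= r0 by rewrite ltW.
apply: norm_leW (norm_le_shrink rr r0_gt0 (h1 i) (hN i)).
have -> : (r / r0) ^+ 1 * N = N / (r0 * e) * r * e by field; rewrite !gt_eqF.
by rewrite ler_piMl ?(ltW e0).
Qed.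

Lemma local_of_vars n p (h : 'I_n -> cps p K) :
  (forall i, h i \in @cps_max p K) ->
  exists phi : {lrmorphism cps n K -> cps p K},
    [/\ is_local phi, forall i, phi (cps_var K i) = h i
      & forall f, coef (phi f) = fps_subst (fun i => coef (h i)) (coef f)].
Proof.
move=> hm; have h1 i : ord_ge 1 (coef (h i)) by apply/cps_maxP.
have Fc f : fps_subst (fun i => coef (h i)) (coef f) \in @convergent p K.
  apply/asboolP/convergent_subst => // [i|]; exact: is_convergent_coef.
pose F (f : cps n K) : cps p K := CPS (Fc f).
have FL : linear F.
  by move=> c f g; apply: cps_inj; rewrite cpsDE cpsZE; exact: fps_subst_linear.
have FM : monoid_morphism F.
  have [S1 SM] := fps_subst_monoid h1.
  by split=> [|f g]; apply: cps_inj; [exact: S1|rewrite cpsME; exact: SM].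
have [phi phiE] := lrmorphism_of FL FM; exists phi; split=> [g|i|f].
- move=> /cps_maxP gm; rewrite phiE; apply/cps_maxP; exact: ord_ge_subst.
- by apply: cps_inj; rewrite phiE; exact: fps_subst_var.
- by rewrite phiE.
Qed.

End Local.

(** * Fixed points of degreewise contractions *)

Section FixedPoint.
Context (n p : nat) (K : numFieldType)
  (T : ('I_p -> fps n K) -> 'I_p -> fps n K).
Context (e : nat) (r s : K).
Implicit Types h : 'I_p -> fps n K.

Let in_ball h := forall i, ord_ge e (h i) /\ norm_le r (h i) s.

Hypothesis s_ge0 : 0 <= s.
Hypothesis T_ball : forall h, in_ball h -> in_ball (T h).
Hypothesis T_contract : forall d h h',
  (forall i, ord_ge e (h i)) -> (forall i, ord_ge e (h' i)) ->
  (forall i, ord_ge d (h i - h' i)) -> forall i, ord_ge d.+1 (T h i - T h' i).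

(** The iterates of 0 stabilise degree by degree, which gives a formal fixed
point. Each of its partial sums is a partial sum of some iterate, so it satisfies
the same bound. *)
Lemma fixed_point : exists h, in_ball h /\ forall i, T h i = h i.
Proof.
pose it N := iter N T (fun=> 0).
have it_ball N : in_ball (it N).
  elim: N => [i|N]; last exact: T_ball.
  by split; [exact: ord_ge_zero|exact: norm_le_zero].
have it_ord N i : ord_ge e (it N i) by have [] := it_ball N i.
have it_step N i : ord_ge N (it N.+1 i - it N i).
  by elim: N i => [//|N IHN] i; apply: T_contract IHN i.
have it_close N N' i : (N <= N')%N -> ord_ge N (it N' i - it N i).
  elim: N' => [|N' IHN']; first by rewrite leqn0 => /eqP ->.
  rewrite leq_eqVlt => /orP[/eqP ->|le_NN']; first by rewrite subrr.
  rewrite -(subrKA (it N' i)); apply: ord_geD; last exact: IHN'.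
  exact: ord_geW (it_step _ _).
pose h i : fps n K := fun m => it (mdeg m).+1 i m.
have h_close N i : ord_ge N (h i - it N i).
  move=> m lt_m; apply/eqP; rewrite -oppr_eq0 fps_subE opprB; apply/eqP.
  exact: it_close.
have h_ord i : ord_ge e (h i) by move=> m lt_m; exact: it_ord.
exists h; split=> i.
  split=> // d; have [_ /(_ d)] := it_ball d i; apply: le_trans.
  apply: ler_sum => -[m lt_m] _ /=; have := h_close d i m lt_m.
  by rewrite fps_subE => /subr0_eq ->.
apply/eqP; rewrite -subr_eq0; apply/eqP/ord_ge_eq0 => d.
apply: (@ord_geW _ _ d.+1) => //.
rewrite -(subrKA (it d.+1 i)); apply: ord_geD; last first.
  by rewrite -opprB; apply: ord_geN; exact: h_close.
by apply: T_contract => // j; exact: h_close.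
Qed.

End FixedPoint.

(** * The inverse function theorem *)

Section InverseFunction.
Context (n : nat) (K : numFieldType).

Lemma ord_ge2P (F : fps n K) :
  ord_ge 2 F <-> F 0%MM = 0 /\ forall i, F U_(i)%MM = 0.
Proof.
split=> [F2|[F0 FU] m]; first by split=> [|i]; apply: F2; rewrite ?mdeg0 ?mdeg1.
rewrite ltnS leq_eqVlt ltnS leqn0 mdeg_eq0 =>
  /orP[/mdeg1P[i /eqP ->]|/eqP -> //].
exact: FU.
Qed.

Definition linear_form (a : 'I_n -> K) : cps n K := \sum_i a i *: cps_var K i.

Lemma linear_form_lin a i : coef (linear_form a) U_(i)%MM = a i.
Proof.
rewrite cps_sumE fps_sumE (bigD1 i) //= fps_scaleE /fps_var eqxx mulr1.
rewrite big1 ?addr0 // => j ji; rewrite fps_scaleE eq_mnm1.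
by rewrite eq_sym (negbTE ji) mulr0.
Qed.

Lemma linear_form_max a : linear_form a \in @cps_max n K.
Proof.
apply/cps_maxP; rewrite cps_sumE; apply: ord_ge_sum => i _.
by rewrite cpsZE; apply: ord_geZ; exact: ord_ge1_var.
Qed.

Lemma ord_ge2_sub_linear f : f \in @cps_max n K ->
  ord_ge 2 (coef (f - linear_form (fun i => coef f U_(i)%MM))).
Proof.
move=> fm; apply/ord_ge2P; rewrite cpsBE; split=> [|i]; rewrite fps_subE.
  by have /cps_maxP/ord_ge1 -> := fm;
    have /cps_maxP/ord_ge1 -> := linear_form_max (fun i => coef f U_(i)%MM);
      rewrite subr0.
by rewrite linear_form_lin subrr.
Qed.

Section LeftInverse.
Context (L : 'M[K]_n) (G : 'I_n -> cps n K).
Hypothesis G2 : forall i, ord_ge 2 (coef (G i)).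

Let T (h : 'I_n -> fps n K) (i : 'I_n) : fps n K :=
  \sum_j invmx L i j *: (fps_var K j - fps_subst h (coef (G j))).

(** The inverse [h] of [x |-> L x + G x] solves [h = L^-1 (x - G h)]. Since [G]
vanishes to order 2, the right-hand side is a degreewise contraction, and on the
polydisc of small radius [r] it preserves the ball of radius [2 C r], with [C]
bounding the row sums of [L^-1]. *)
Lemma inverse_fixed_point : exists h : 'I_n -> cps n K,
  (forall i, h i \in @cps_max n K) /\ forall i, T (fun j => coef (h j)) i =
    coef (h i).
Proof.
have [e [M [e0 M0 GM]]] :=
  convergent_family (fun i => is_convergent_coef (G i)).
(* On that ball [G] has norm at most [(2 C r / e) ^ 2 M], and the second bound
   on the radius makes this at most [r]. *)
pose C := 1 + \sum_i \sum_j `|invmx L i j|.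
have C1 : 1 <= C by rewrite lerDl; apply: sumr_ge0 => i _; exact: sumr_ge0.
have C0 : 0 < C by rewrite (lt_le_trans _ C1).
have [] := @small_radius K (e / (2 * C)) (4 * C ^+ 2 * M / e ^+ 2).
- by rewrite divr_gt0 // mulr_gt0.
- apply: divr_ge0; [apply: mulr_ge0 => //; apply: mulr_ge0 => //|];
    by apply: exprn_ge0; exact: ltW.
move=> r [r0 le_re le_r1]; pose s := 2 * C * r.
have s0 : 0 < s by rewrite !mulr_gt0.
have se : 0 <= s <= e.
  by rewrite ltW //= /s mulrC -ler_pdivlMr // mulr_gt0.
have [|h h_ball d h' h1 h'1 hh' i|h [h_ball hT]] :=
  @fixed_point n n K T 1 r s (ltW s0).
- move=> h h_ball i; have h1 j : ord_ge 1 (h j) by have [] := h_ball j.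
  split.
    apply: ord_ge_sum => j _; apply/ord_geZ/ord_geB; first exact: ord_ge1_var.
    by apply: ord_ge_subst => //; apply: ord_geW (G2 j).
  apply: (@norm_leW _ _ _ _ (\sum_j `|invmx L i j| * (r + r))).
    have -> : s = C * (r + r) by rewrite /s; ring.
    rewrite -mulr_suml ler_wpM2r ?addr_ge0 ?(ltW r0) //.
    rewrite /C [X in _ <= 1 + X](bigD1 i) //= addrCA lerDl addr_ge0 //.
    by apply: sumr_ge0 => j _; exact: sumr_ge0.
  apply: norm_le_sum => [|j _]; first exact: ltW.
  apply/norm_leZ/norm_leB; [exact: ltW|by apply: norm_le_var; exact: ltW|].
  apply: (@norm_leW _ _ _ _ ((s / e) ^+ 2 * M)).
    have -> : (s / e) ^+ 2 * M = 4 * C ^+ 2 * M / e ^+ 2 * r * r.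
      by rewrite /s; field; rewrite gt_eqF.
    by rewrite ler_piMl ?(ltW r0).
  apply: (@norm_le_subst _ _ _ _ _ _ s) => //; try exact: ltW.
    by move=> k; have [] := h_ball k.
  exact: norm_le_shrink.
- rewrite -sumrB; apply: ord_ge_sum => j _; rewrite -scalerBr; apply: ord_geZ.
  rewrite opprB addrC addrA subrK -opprB; apply: ord_geN.
  by rewrite -addn1; apply: ord_ge_subst_sub.
have hc i : is_convergent (h i).
  by apply/is_convergentP; exists r, s; have [] := h_ball i.
have /choice[H HE] i := cps_of_convergent (hc i).
have hE : (fun j => coef (H j)) = h by apply/funext => j; rewrite HE.
exists H; split=> i; first by apply/cps_maxP; rewrite HE; have [] := h_ball i.
by rewrite hE hT HE.
Qed.

End LeftInverse.

Lemma local_left_inverse (phi : {lrmorphism cps n K -> cps n K}) :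
  is_local phi -> jacobian phi \in unitmx ->
  exists psi : {lrmorphism cps n K -> cps n K}, is_local psi /\ cancel phi psi.
Proof.
move=> phi1 L_unit; set L := jacobian phi in L_unit.
pose G i := phi (cps_var K i) - linear_form (L i).
have G2 i : ord_ge 2 (coef (G i)).
  rewrite /G (_ : L i = fun j => coef (phi (cps_var K i)) U_(j)%MM).
    by apply/ord_ge2_sub_linear/phi1/cps_max_var.
  by apply/funext => j; rewrite mxE.
have [h [h1 hT]] := inverse_fixed_point L G2.
have [psi [psi1 psi_var psiE]] := local_of_vars h1.
exists psi; split=> // f; pose id' : {lrmorphism cps n K -> cps n K} := idfun.
apply: (@local_ext _ _ _ (psi \o phi) id') => // [|i].
  exact: local_comp.
rewrite /= -[phi _](subrK (linear_form (L i))) -/(G i) rmorphD rmorph_sum /=.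
have hE j : h j = \sum_l invmx L j l *: (cps_var K l - psi (G l)).
  apply: cps_inj; rewrite -hT cps_sumE; apply: eq_bigr => l _.
  by rewrite cpsZE cpsBE psiE.
rewrite (eq_bigr (fun j => \sum_l (L i j * invmx L j l) *:
  (cps_var K l - psi (G l)))).
  rewrite exchange_big /=
    (eq_bigr (fun l => (i == l)%:R *: (cps_var K l - psi (G l)))).
    rewrite (bigD1 i) //= eqxx scale1r big1 ?addr0 ?subrKC // => j ji.
    by rewrite eq_sym (negbTE ji) scale0r.
  move=> l _; rewrite -scaler_suml; congr (_ *: _).
  by have /matrixP/(_ i l) := mulmxV L_unit; rewrite !mxE.
move=> j _; rewrite linearZ /= psi_var hE scaler_sumr; apply: eq_bigr => l _.
by rewrite scalerA.
Qed.

(** A left inverse has itself a left inverse, because its Jacobian matrix is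
invertible too; hence it is a two-sided inverse. *)
Lemma local_bijective (phi : {lrmorphism cps n K -> cps n K}) :
  is_local phi -> jacobian phi \in unitmx -> bijective phi.
Proof.
move=> phi1 L_unit; have [psi [psi1 phiK]] := local_left_inverse phi1 L_unit.
have [|chi [chi1 psiK]] := @local_left_inverse psi psi1.
  suff /mulmx1_unit[] : jacobian phi *m jacobian psi = 1%:M by [].
  by rewrite -jacobian_comp // -jacobian_id; apply: eq_jacobian => f;
    exact: phiK.
by exists psi => // f; rewrite -[phi _]psiK phiK psiK.
Qed.

End InverseFunction.

(** * Quadratic parts *)

Section Hessian.
Context (n : nat) (K : numFieldType).
Implicit Types (f g a b : cps n K) (S : 'M[K]_n).

Lemma hessianE f i j :
  hessian f i j = coef f (U_(i) + U_(j))%MM *+ (i == j).+1.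
Proof. by rewrite mxE /fps_deriv add0m mnm1E mnm0E. Qed.

Lemma hessianD f g : hessian (f + g) = hessian f + hessian g.
Proof. by apply/matrixP => i j;
  rewrite hessianE [RHS]mxE !hessianE cpsDE fps_addE mulrnDl. Qed.

Lemma hessianZ c f : hessian (c *: f) = c *: hessian f.
Proof. by apply/matrixP => i j;
  rewrite hessianE [RHS]mxE !hessianE cpsZE fps_scaleE mulrnAr. Qed.

Lemma hessian_sum (I : Type) (r : seq I) (P : pred I) (F : I -> cps n K) :
  hessian (\sum_(i <- r | P i) F i) = \sum_(i <- r | P i) hessian (F i).
Proof.
apply: (big_morph (@hessian n K) hessianD).
by apply/matrixP => i j; rewrite hessianE mxE mul0rn.
Qed.

Lemma tr_hessian f : (hessian f)^T = hessian f.
Proof. by apply/matrixP => i j; rewrite [LHS]mxE !hessianE addmC eq_sym. Qed.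

Lemma hessian_ord3 f : ord_ge 3 (coef f) -> hessian f = 0.
Proof.
move=> f3; apply/matrixP => i j; rewrite hessianE f3 ?mul0rn ?mxE //.
by rewrite mdegD !mdeg1.
Qed.

(** In characteristic 0 no coefficient of degree 2 is lost in the Hessian. *)
Lemma ord_ge3_hessian f : ord_ge 2 (coef f) -> hessian f = 0 ->
  ord_ge 3 (coef f).
Proof.
move=> f2 hf m; rewrite ltnS leq_eqVlt => /orP[/eqP dm|]; last exact: f2.
have [i mi] : exists i, m i != 0%N.
  apply/existsP; rewrite -negb_forall; apply/negP => /forallP m0.
  by move: dm; rewrite mdegE big1 // => i _; apply/eqP.
have mE : m = (m - U_(i) + U_(i))%MM by rewrite submK // lep1mP.
have /mdeg1P[j /eqP ej] : mdeg (m - U_(i))%MM == 1%N.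
  by move: dm; rewrite {1}mE mdegD mdeg1 addn1 => -[->].
have /matrixP/(_ j i)/eqP := hf; rewrite hessianE mxE -ej -mE.
by rewrite mulrn_eq0 => /eqP.
Qed.

Lemma hessian_varM (i j : 'I_n) :
  hessian (cps_var K i * cps_var K j) = delta_mx i j + delta_mx j i.
Proof.
apply/matrixP => k l;
  rewrite hessianE cpsME !coef_var fps_varM_coef !mxE mnmDE !mnm1E.
rewrite (eq_sym k i) (eq_sym l i) (eq_sym k j) (eq_sym l j).
have [<-|ik] := eqVneq i k.
  rewrite addmC addmK /fps_var eq_mnm1 (eq_sym l j) (eq_sym j i).
  have [<-|il] := eqVneq i l; last by rewrite andbF addr0 mulr1n.
  by rewrite /= mulr2n andbT (eq_sym i).
rewrite add0n; have [<-|il] := eqVneq i l; last by rewrite mul0rn andbF addr0.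
rewrite addmK /fps_var eq_mnm1 (eq_sym k i) (negbTE ik) mulr1n add0r andbT.
by rewrite (eq_sym k).
Qed.

Definition quadratic_form S : cps n K :=
  \sum_i \sum_j S i j *: (cps_var K i * cps_var K j).

Lemma sum_delta_mx S : \sum_i \sum_j S i j *: delta_mx i j = S.
Proof. by rewrite [RHS]matrix_sum_delta. Qed.

Lemma hessian_quadratic_form S : hessian (quadratic_form S) = S + S^T.
Proof.
rewrite -{2}[S]sum_delta_mx -{3}[S]sum_delta_mx hessian_sum raddf_sum
  -big_split.
apply: eq_bigr => i _; rewrite /= hessian_sum raddf_sum -big_split.
apply: eq_bigr => j _; rewrite /= hessianZ hessian_varM scalerDr.
by rewrite linearZ /= trmx_delta.
Qed.

Lemma ord_ge2_quadratic_form S : ord_ge 2 (coef (quadratic_form S)).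
Proof.
rewrite cps_sumE; apply: ord_ge_sum => i _; rewrite cps_sumE.
apply: ord_ge_sum => j _; rewrite cpsZE; apply: ord_geZ.
by rewrite cpsME; apply: (@ord_geM _ _ 1 1); exact: ord_ge1_var.
Qed.

Lemma quadratic_part f : ord_ge 2 (coef f) ->
  ord_ge 3 (coef (f - quadratic_form (2^-1 *: hessian f))).
Proof.
move=> f2; apply: ord_ge3_hessian.
  by rewrite cpsBE; apply: ord_geB => //; exact: ord_ge2_quadratic_form.
rewrite -scaleN1r hessianD hessianZ hessian_quadratic_form linearZ /=
  tr_hessian.
rewrite -scalerDl (_ : 2^-1 + 2^-1 = 1) ?scaleN1r ?scale1r ?subrr //.
by field.
Qed.

Lemma hessianM a b : a \in @cps_max n K -> b \in @cps_max n K ->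
  hessian (a * b) = \matrix_(i, j) (coef a U_(i)%MM * coef b U_(j)%MM
                                  + coef b U_(i)%MM * coef a U_(j)%MM).
Proof.
move=> am bm.
pose la := linear_form (fun i => coef a U_(i)%MM).
pose lb := linear_form (fun i => coef b U_(i)%MM).
have a2 := ord_ge2_sub_linear am; have b2 := ord_ge2_sub_linear bm.
have [/cps_maxP b1 /cps_maxP l1] :=
  (bm, linear_form_max (fun i => coef a U_(i)%MM)).
have -> : a * b = la * lb + ((a - la) * b + la * (b - lb)) by ring.
rewrite hessianD [X in _ + X]hessian_ord3 ?addr0; last first.
  rewrite cpsDE !cpsME; apply: ord_geD; first exact: (@ord_geM _ _ 2 1).
  exact: (@ord_geM _ _ 1 2).
rewrite /la /lb /linear_form big_distrlr /=.
pose S : 'M[K]_n := \matrix_(i, j) (coef a U_(i)%MM * coef b U_(j)%MM).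
rewrite (_ : \sum_i _ = quadratic_form S); last first.
  apply: eq_bigr => i _; apply: eq_bigr => j _.
  by rewrite -scalerAl -scalerAr scalerA mxE.
rewrite hessian_quadratic_form; apply/matrixP => i j; rewrite !mxE.
by rewrite [X in _ + X]mulrC.
Qed.

End Hessian.

Section HessianMorphism.
Context (n p : nat) (K : numFieldType).

Lemma congruence_coef (J : 'M[K]_(n, p)) (S : 'M[K]_n) k l :
  (J^T *m S *m J) k l = \sum_i \sum_j S i j * (J i k * J j l).
Proof.
rewrite mxE; under eq_bigr do rewrite mxE mulr_suml.
rewrite exchange_big; apply: eq_bigr => i _; apply: eq_bigr => j _.
by rewrite mxE mulrA [J i k * _]mulrC.
Qed.

(** Only the quadratic part of [f] and the linear parts of the images of the
variables contribute in degree 2. *)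
Lemma hessian_local (phi : {lrmorphism cps n K -> cps p K}) f :
  is_local phi -> ord_ge 2 (coef f) ->
  hessian (phi f) = (jacobian phi)^T *m hessian f *m jacobian phi.
Proof.
move=> phi1 f2; have := quadratic_part f2.
set S := 2^-1 *: _; set c := f - _ => c3.
have -> : hessian f = S + S^T.
  rewrite /S linearZ /= tr_hessian -scalerDl (_ : 2^-1 + 2^-1 = 1) ?scale1r //.
  by field.
have -> : f = quadratic_form S + c by rewrite /c addrC subrK.
have c'3 : ord_ge 3 (coef (phi c)) by exact: local_ord.
rewrite rmorphD hessianD (hessian_ord3 c'3) addr0 rmorph_sum hessian_sum.
have E i j : hessian (phi (S i j *: (cps_var K i * cps_var K j))) =
    S i j *: \matrix_(k, l) (jacobian phi i k * jacobian phi j l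
                            + jacobian phi j k * jacobian phi i l).
  rewrite linearZ /= hessianZ rmorphM hessianM; try exact/phi1/cps_max_var.
  by congr (_ *: _); apply/matrixP => k l; rewrite !mxE.
rewrite mulmxDr mulmxDl.
have -> : (jacobian phi)^T *m S^T *m jacobian phi =
    ((jacobian phi)^T *m S *m jacobian phi)^T by rewrite !trmx_mul trmxK mulmxA.
apply/matrixP => k l; rewrite summxE mxE [X in _ + X]mxE !congruence_coef.
rewrite -big_split; apply: eq_bigr => i _.
rewrite rmorph_sum hessian_sum summxE -big_split; apply: eq_bigr => j _.
by rewrite E !mxE mulrDr [X in _ + _ * X]mulrC.
Qed.

End HessianMorphism.

(** * Powers of the maximal ideal *)

Section IdealPower.
Context (n : nat) (K : numFieldType).
Local Notation M := (@cps_max n K).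

Lemma ideal_pow0 (f : cps n K) : ideal_pow M 0 f.
Proof.
exists 1%N, (fun=> f), (fun _ _ => 0); split=> [_ []//|].
by rewrite big_ord1 big_ord0 mulr1.
Qed.

Lemma ideal_pow_zero j : ideal_pow M j 0.
Proof.
exists 0%N, (fun=> 0), (fun _ _ => 0); split=> [[]//|].
by rewrite big_ord0.
Qed.

Lemma ideal_powD j f g : ideal_pow M j f -> ideal_pow M j g ->
  ideal_pow M j (f + g).
Proof.
move=> [N1 [c1 [h1 [m1 ->]]]] [N2 [c2 [h2 [m2 ->]]]].
pose c i := match fintype.split i with inl i => c1 i | inr i => c2 i end.
pose h i := match fintype.split i with inl i => h1 i | inr i => h2 i end.
exists (N1 + N2)%N, c, h; split=> [i l|]; first by rewrite /h;
  case: fintype.split.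
rewrite big_split_ord; congr (_ + _); apply: eq_bigr => i _; rewrite /c /h.
  by rewrite (unsplitK (inl i)).
by rewrite (unsplitK (inr i)).
Qed.

Lemma ideal_powS j x f : x \in M -> ideal_pow M j f -> ideal_pow M j.+1 (x * f).
Proof.
move=> xm [N [c [h [hm ->]]]].
exists N, c, (fun i l => if unlift ord0 l is Some l' then h i l' else x).
split=> [i l|]; first by case: unlift.
rewrite mulr_sumr; apply: eq_bigr => i _.
rewrite big_ord_recl unlift_none mulrCA; congr (_ * (_ * _)).
by apply: eq_bigr => l _; rewrite liftK.
Qed.

(** A series vanishing to order [j] lies in the [j]-th power of the maximal
ideal by repeated use of Hadamard's lemma. *)
Lemma ideal_powP j (f : cps n K) : ideal_pow M j f <-> ord_ge j (coef f).
Proof.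
split=> [[N [c [h [hm ->]]]]|].
  rewrite cps_sumE; apply: ord_ge_sum => i _;
    rewrite cpsME -[X in ord_ge X]add0n.
  apply: ord_geM => //.
  have -> : coef (\prod_(l < j) h i l) = \prod_(l < j) coef (h i l).
    by elim/big_rec2: _ => // l y1 y2 _ <-.
  rewrite -[X in ord_ge X]card_ord -sum1_card; apply: ord_ge_prod => l.
  exact/cps_maxP.
elim: j f => [f _|j IHj f fj]; first exact: ideal_pow0.
rewrite [f]cps_hadamard [coef f _]fj ?mdeg0 // scale0r addr0.
apply: big_ind => [||i _]; first exact: ideal_pow_zero.
  exact: ideal_powD.
by apply: ideal_powS; [exact: cps_max_var|apply/IHj/ord_ge_quot].
Qed.

End IdealPower.

(** * Congruence of symmetric matrices *)

Section SymmetricMatrix.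
Context (F : fieldType) (good : F -> Prop).
Hypothesis two_neq0 : (2 : F) != 0.
Hypothesis goodP : forall x : F, x != 0 -> exists2 y, y != 0 & good (y * y * x).

Lemma congruence_entry n (P A : 'M[F]_n) i j :
  (P *m A *m P^T) i j = (row i P *m A *m (row j P)^T) 0 0.
Proof.
rewrite -row_mul tr_row [LHS]mxE [RHS]mxE; apply: eq_bigr => k _.
by rewrite [row _ _ _ _]mxE [col _ _ _ _]mxE.
Qed.

(** If all diagonal entries vanish, the sum of two basis vectors whose pairing
is nonzero works, as 2 is invertible. *)
Lemma anisotropic_vector n (A : 'M[F]_n) : A^T = A -> A != 0 ->
  exists v : 'rV[F]_n, (v *m A *m v^T) 0 0 != 0.
Proof.
move=> sA A0; have AE i j :
  ((delta_mx 0 i : 'rV_n) *m A *m (delta_mx 0 j : 'rV_n)^T) 0 0 = A i j.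
  by rewrite -rowE trmx_delta -colE !mxE.
have [/existsP[i Aii]|] := boolP [exists i, A i i != 0].
  by exists (delta_mx 0 i); rewrite AE.
rewrite negb_exists => /forallP d0.
have Aii i : A i i = 0 by apply/eqP; rewrite -[_ == _]negbK.
have [/existsP[i /existsP[j Aij]]|] := boolP [exists i, exists j, A i j != 0].
  exists (delta_mx 0 i + delta_mx 0 j).
  have DE (X Y : 'M[F]_1) : (X + Y) 0 0 = X 0 0 + Y 0 0 by rewrite mxE.
  rewrite linearD /= !(mulmxDl, mulmxDr) !DE !AE !Aii add0r addr0.
  have -> : A j i = A i j by rewrite -{1}sA mxE.
  by rewrite -mulr2n -mulr_natl mulf_neq0.
rewrite negb_exists => /forallP A0'; case/eqP: A0; apply/matrixP => i j.
have := A0' i; rewrite negb_exists => /forallP/(_ j); rewrite negbK => /eqP ->.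
by rewrite mxE.
Qed.

(** Complete an anisotropic vector to a basis, rescale so that the corner entry
is normalised, and clear the first row and column (one step of Gram-Schmidt).
The predicate [good] selects representatives of the nonzero elements modulo
squares. *)
Lemma symmetric_split n (A : 'M[F]_(1 + n)) : A^T = A -> A != 0 ->
  exists P c B, [/\ P \in unitmx, good c, c != 0, B^T = B
    & P *m A *m P^T = block_mx c%:M 0 0 (B : 'M[F]_n)].
Proof.
move=> sA A0; have [v vA] := anisotropic_vector sA A0.
have v0 : v != 0 by apply: contraNneq vA => ->; rewrite !mul0mx mxE.
(* The extended row basis of [v] is an invertible matrix whose first row is
   proportional to [v]. *)
pose P1 := row_ebase v; pose u := col_ebase v 0 0.
have vE : v = u *: row 0 P1.
  rewrite -[v in LHS]mulmx_ebase rank_rV v0.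
  rewrite [col_ebase v]mx11_scalar -mulmxA mul_scalar_mx; congr (_ *: _).
  by rewrite rowE; congr (_ *m _); apply/rowP => j; rewrite !mxE andbT eq_sym.
pose x := (P1 *m A *m P1^T) 0 0.
have x0 : x != 0.
  apply: contraNneq vA => x0.
  rewrite vE linearZ /= -!scalemxAl -scalemxAr 2!mxE -congruence_entry.
  by rewrite -/x x0 !mulr0.
have [y y0 good_y] := goodP x0.
(* Scaling the whole matrix is harmless: only the corner entry matters. *)
pose P2 : 'M[F]_(1 + n) := y *: P1.
have P2_unit : P2 \in unitmx by rewrite unitmxZ ?unitfE // row_ebase_unit.
pose X := P2 *m A *m P2^T; pose c := y * y * x.
have c0 : c != 0 by rewrite !mulf_neq0.
have sX : X^T = X by rewrite /X !trmx_mul trmxK sA mulmxA.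
have ulX : ulsubmx X = c%:M.
  rewrite [LHS]mx11_scalar; congr (_ %:M).
  rewrite 2![LHS]mxE (_ : lshift n 0 = 0); last exact: val_inj.
  by rewrite /X linearZ /= -!scalemxAl -scalemxAr 2!mxE mulrA.
pose b := ursubmx X; pose C := drsubmx X.
have XE : X = block_mx c%:M b b^T C.
  by rewrite -ulX /b trmx_ursub sX submxK.
pose E : 'M[F]_(1 + n) := block_mx 1%:M 0 (- (c^-1 *: b^T)) 1%:M.
exists (E *m P2), c, (C - c^-1 *: (b^T *m b)); split=> //.
- by rewrite unitmx_mul P2_unit andbT unitmxE det_lblock !det1 mulr1 unitr1.
- rewrite linearB linearZ /= trmx_mul trmxK; congr (_ - _).
  by rewrite trmx_drsub sX.
have -> : E *m P2 *m A *m (E *m P2)^T = E *m X *m E^T.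
  by rewrite trmx_mul /X !mulmxA.
rewrite XE /E tr_block_mx !trmx1 trmx0 !mulmx_block.
rewrite !(mul1mx, mulmx1, mul0mx, mulmx0, addr0, add0r).
rewrite linearN linearZ /= trmxK !(mulNmx, mulmxN) mul_mx_scalar scalerA divff
  //.
rewrite scale1r addNr mul_scalar_mx scalerA divff // scale1r addNr mul0mx oppr0.
by rewrite add0r -scalemxAl addrC.
Qed.

(** Splitting off one entry lowers the rank by one, so the induction places the
nonzero diagonal entries first. *)
Lemma symmetric_diagonalize n (A : 'M[F]_n) : A^T = A ->
  exists P (a : 'I_n -> F), [/\ P \in unitmx,
    forall i : 'I_n, (i < \rank A)%N -> good (a i)
    & P *m A *m P^T = diag_mx (\row_i (a i *+ (i < \rank A)%N))].
Proof.
elim: n A => [|n IHn] A sA.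
  by exists 1%:M, (fun=> 0); split=> [|[]//|];
    [exact: unitmx1|apply/matrixP => -[]].
have [->|A0] := eqVneq A 0.
  exists 1%:M, (fun=> 0); split=> [|i|]; rewrite ?unitmx1 ?mxrank0 //.
  rewrite mulmx0 mul0mx; apply/matrixP => i j.
  by rewrite !mxE !mul0rn.
have [P [c [B [P_unit good_c c0 sB AE]]]] := symmetric_split (n := n) sA A0.
have [Q [b [Q_unit good_b BE]]] := IHn B sB.
have rA : \rank A = (\rank B).+1.
  rewrite -(mxrankMfree A (B := P^T)) ?row_free_unit ?unitmx_tr //.
  rewrite -(eqmxMfull (A := P)) ?row_full_unit // mulmxA AE rank_diag_block_mx.
  by rewrite mxrank_unit // unitmxE det_scalar1 unitfE.
pose a (i : 'I_(1 + n)) :=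
  match fintype.split i with inl _ => c | inr j => b j end.
have aL i : a (lshift n i) = c by rewrite /a (unsplitK (inl i)).
have aR i : a (rshift 1 i) = b i by rewrite /a (unsplitK (inr i)).
pose D : 'M[F]_(1 + n) := block_mx 1%:M 0 0 Q.
have D_unit : D \in unitmx by rewrite unitmxE det_ublock det1 mul1r.
have DE : D *m block_mx c%:M 0 0 B *m D^T = block_mx c%:M 0 0 (Q *m B *m Q^T).
  rewrite tr_block_mx !trmx0 trmx1 !mulmx_block.
  by rewrite !(mul1mx, mulmx1, mul0mx, mulmx0, addr0, add0r).
exists (D *m P), a; split=> [|i|].
- by rewrite unitmx_mul P_unit andbT; exact: D_unit.
- rewrite rA; case: (split_ordP (i : 'I_(1 + n))) => j -> /=;
  rewrite ?aL ?aR //.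
  by rewrite add1n ltnS; exact: good_b.
rewrite trmx_mul mulmxA -(mulmxA _ P) -(mulmxA _ (P *m A)) AE.
apply: etrans DE _; rewrite BE rA.
apply/matrixP => i j; rewrite [RHS]mxE [X in _ = X *+ _]mxE.
case: (split_ordP (i : 'I_(1 + n))) => i' ->;
  case: (split_ordP (j : 'I_(1 + n))) => j' ->.
- by rewrite block_mxEul aL (ord1 i') (ord1 j') mxE !eqxx.
- by rewrite block_mxEur mxE (ord1 i') -val_eqE.
- by rewrite block_mxEdl mxE (ord1 j') -val_eqE.
- by rewrite block_mxEdr aR -[_ == _]val_eqE /= eqSS val_eqE add1n ltnS [LHS]mxE
  [X in X *+ _ = _]mxE.
Qed.

End SymmetricMatrix.

(** * Series in the last variables *)

Section TailVariables.
Context (n k : nat) (K : numFieldType).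
Local Notation tail := (@tail_ord n k).

Lemma tail_ord_inj : injective tail.
Proof. by move=> i j /(congr1 val) /= /addnI/val_inj. Qed.

Lemma tail_ordP (i : 'I_n) : (k <= i)%N -> exists j, i = tail j.
Proof.
move=> le_ki; have lt_j :
  (i - k < n - k)%N by rewrite ltn_sub2r // (leq_ltn_trans le_ki).
by exists (Ordinal lt_j); apply: val_inj; rewrite /= subnKC.
Qed.

Lemma tail_ord_ge j : (tail j < k)%N = false.
Proof. by apply/negbTE; rewrite -leqNgt leq_addr. Qed.

Lemma fps_tail_varM j (G : fps (n - k) K) :
  fps_tail (fps_var K j * G) = fps_var K (tail j) * fps_tail G.
Proof.
apply/funext => m; rewrite fps_varM_coef /fps_tail fps_varM_coef mnmE.
have [mj|//] := ltnP 0 (m (tail j)); last by rewrite if_same.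
have -> : head_free k (m - U_(tail j))%MM = head_free k m.
  apply: eq_forallb => i; case: ltnP => //= ik; rewrite mnmBE mnm1E.
  case: (tail j =P i) => [e|_]; last by rewrite subn0.
  by move: ik; rewrite -e tail_ord_ge.
congr (if _ then G _ else _); apply/mnmP => i; rewrite mnmBE !mnmE.
by rewrite (inj_eq tail_ord_inj).
Qed.

Lemma fps_tailD (G H : fps (n - k) K) :
  fps_tail (G + H) = fps_tail G + fps_tail H.
Proof.
apply/funext => m; rewrite fps_addE /fps_tail.
by case: ifP => _; rewrite ?addr0.
Qed.

Lemma fps_tail_alg c : fps_tail (c%:A : fps (n - k) K) = c%:A.
Proof.
apply/funext => m; rewrite /fps_tail !fps_algE; case: ifP => hm.
  congr (_ *+ nat_of_bool _).
  have t0 : @mnm_tail n k 0%MM = 0%MM by apply/mnmP => j; rewrite !mnmE.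
  apply/eqP/eqP => [|->//]; rewrite -t0; apply: mnm_tail_inj => //.
  by apply/forallP => i; rewrite mnmE eqxx implybT.
case: eqP => // m0; move: hm; rewrite m0; case/negP.
by apply/forallP => i; rewrite mnmE eqxx implybT.
Qed.

Lemma fps_tail_sum I (r : seq I) (P : pred I) (F : I -> fps (n - k) K) :
  fps_tail (\sum_(i <- r | P i) F i) = \sum_(i <- r | P i) fps_tail (F i).
Proof.
apply: big_morph => [G H|]; first exact: fps_tailD.
by have := fps_tail_alg 0; rewrite !scale0r.
Qed.

Lemma coef_tail (g : cps (n - k) K) : coef (cps_tail g) = fps_tail (coef g).
Proof. by []. Qed.

(** The inclusion of the series in the last variables commutes with
multiplication by a variable, so Hadamard's lemma identifies it with the
substitution that it should be; in particular it is a ring morphism. *)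
Lemma tail_embedding : exists iota : {lrmorphism cps (n - k) K -> cps n K},
  [/\ is_local iota, forall j, iota (cps_var K j) = cps_var K (tail j)
    & iota =1 @cps_tail n K k].
Proof.
have [iota [iota1 iota_var _]] :=
  local_of_vars (fun j : 'I_(n - k) => cps_max_var K (tail j)).
exists iota; split=> // g; apply: cps_inj; apply/eqP; rewrite -subr_eq0;
  apply/eqP.
apply: ord_ge_eq0 => d; elim: d g => [//|d IHd] g.
rewrite (lrmorph_hadamard iota) coef_tail {2}(fps_hadamard (coef g)) fps_tailD
  fps_tail_alg.
rewrite cpsDE cps_algE opprD addrACA subrr addr0 cps_sumE.
rewrite fps_tail_sum -sumrB; apply: ord_ge_sum => j _.
rewrite fps_tail_varM cpsME iota_var -mulrBr -[d.+1]add1n.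
by apply: ord_geM; [exact: ord_ge1_var|exact: IHd].
Qed.

Lemma tail_projection : exists pi : {lrmorphism cps n K -> cps (n - k) K},
  [/\ is_local pi, forall j, pi (cps_var K (tail j)) = cps_var K j
    & forall i : 'I_n, (i < k)%N -> pi (cps_var K i) = 0].
Proof.
pose h (i : 'I_n) : cps (n - k) K :=
  if [pick j | tail j == i] is Some j then cps_var K j else 0.
have [|pi [pi1 pi_var _]] := @local_of_vars K n (n - k) h.
  move=> i; rewrite /h; case: pickP => [j _|_]; first exact: cps_max_var.
  exact/cps_maxP/ord_ge_zero.
exists pi; split=> // [j|i ik]; rewrite pi_var /h; case: pickP => [j'|] //.
- by move=> /eqP/tail_ord_inj ->.
- by move=> /(_ j); rewrite eqxx.
- by move=> /eqP e; move: ik; rewrite -e tail_ord_ge.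
Qed.

Lemma head_free_addU (i : 'I_n) m : head_free k (m + U_(i))%MM ->
  (k <= i)%N /\ head_free k m.
Proof.
move=> /forallP h; split.
  by rewrite leqNgt; apply/negP => ik; have := h i;
    rewrite ik mnmDE mnm1E eqxx addn1.
apply/forallP => j; apply/implyP => jk; have := h j; rewrite jk mnmDE.
by rewrite addn_eq0 => /andP[].
Qed.

(** If [f] involves only the last variables, so do its Hadamard quotients, and
those by the first variables vanish. *)
Lemma local_fix_tail (psi : {lrmorphism cps n K -> cps n K}) (f : cps n K) :
  is_local psi -> (forall j, psi (cps_var K (tail j)) = cps_var K (tail j)) ->
  (forall m, ~~ head_free k m -> coef f m = 0) -> psi f = f.
Proof.
move=> psi1 psi_tail hf; apply: cps_inj; apply/eqP; rewrite -subr_eq0;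
  apply/eqP.
apply: ord_ge_eq0 => d; elim: d f hf => [//|d IHd] f hf.
rewrite {2}[f]cps_hadamard (lrmorph_hadamard psi) !cpsDE opprD addrACA subrr
  addr0.
rewrite !cps_sumE -sumrB; apply: ord_ge_sum => i _; rewrite !cpsME.
have hq m : ~~ head_free k m -> coef (cps_quot i f) m = 0.
  move=> hm; rewrite coef_quot /fps_quot hf ?if_same //.
  by apply: contra hm => /head_free_addU[].
have [le_ki|lt_ik] := leqP k i.
  have [j ij] := tail_ordP le_ki;
    rewrite {1}ij psi_tail -ij -mulrBr -[d.+1]add1n.
  by apply: ord_geM; [exact: ord_ge1_var|exact: IHd hq].
have -> : cps_quot i f = 0.
  apply: cps_inj; apply/funext => m; rewrite coef_quot /fps_quot hf ?if_same //.
  by apply/negP => /head_free_addU[]; rewrite leqNgt lt_ik.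
by rewrite rmorph0 !mulr0 subrr.
Qed.

(** The preimage is obtained by setting the first variables to 0, which keeps
it convergent for free. *)
Lemma head_free_is_tail (f : cps n K) d : ord_ge d (coef f) ->
  (forall m, ~~ head_free k m -> coef f m = 0) ->
  exists g : cps (n - k) K, ord_ge d (coef g) /\ cps_tail g = f.
Proof.
move=> fd hf; have [iota [iota1 iota_var iotaE]] := tail_embedding.
have [pi [pi1 pi_var _]] := tail_projection.
exists (pi f); split; first exact: local_ord.
rewrite -iotaE; apply: (@local_fix_tail (iota \o pi)) => // [|j].
  exact: local_comp.
by rewrite /= pi_var iota_var.
Qed.

End TailVariables.

(** * Splitting off the squares *)

Section Splitting.
Context (n k : nat) (K : numFieldType) (a : 'I_n -> K).
Hypotheses (le_kn : (k <= n)%N)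
  (a_neq0 : forall i : 'I_n, (i < k)%N -> a i != 0).

Section Equation.
Context (C : fps n K).
Hypotheses (C3 : ord_ge 3 C) (Cc : is_convergent C).
Implicit Types u : 'I_n -> fps n K.

(** For [x_i |-> x_i + u_i] to carry [q + C] to [q] plus a series in the last
variables, where [q] is the sum of the [a i * x_i ^ 2], the cross terms
[2 a i x_i u_i] must cancel the part of this error that involves the first [k]
variables. Dividing the error by these variables yields the equation
[u = splitting_operator u]. *)
Definition splitting_error u : fps n K :=
  \sum_(i < n | (i < k)%N) a i *: (u i * u i) +
  fps_subst (fun i => fps_var K i + u i) C.

Definition splitting_operator u (i : 'I_n) : fps n K :=
  if (i < k)%N then - (2 * a i)^-1 *: fps_quot i (splitting_error u) else 0.

Lemma ord_ge1_shift u i : ord_ge 2 (u i) -> ord_ge 1 (fps_var K i + u i).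
Proof. by move=> u2; apply: ord_geD;
  [exact: ord_ge1_var|exact: ord_geW u2]. Qed.

Lemma ord_ge3_splitting_error u : (forall i, ord_ge 2 (u i)) ->
  ord_ge 3 (splitting_error u).
Proof.
move=> u2; apply: ord_geD.
  apply: ord_ge_sum => i _; apply: ord_geZ.
  by apply: (@ord_geW _ _ 4) => //; exact: (@ord_geM _ _ 2 2).
by apply: ord_ge_subst => // i; exact: ord_ge1_shift.
Qed.

Lemma splitting_operator_ord u i : (forall j, ord_ge 2 (u j)) ->
  ord_ge 2 (splitting_operator u i).
Proof.
move=> u2; rewrite /splitting_operator; case: ifP => // _.
by apply/ord_geZ/ord_ge_quot/ord_ge3_splitting_error.
Qed.

(** Both parts of the error gain two degrees over [u - u'], as [u] vanishes to
order 2 and [C] to order 3, and the division loses only one. *)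
Lemma splitting_operator_contract d u u' :
  (forall i, ord_ge 2 (u i)) -> (forall i, ord_ge 2 (u' i)) ->
  (forall i, ord_ge d (u i - u' i)) ->
  forall i, ord_ge d.+1 (splitting_operator u i - splitting_operator u' i).
Proof.
move=> u2 u'2 uu' i; rewrite /splitting_operator; case: (ltnP i k) => _;
  last first.
  by rewrite subrr; exact: ord_ge_zero.
rewrite -scalerBr -fps_quotB; apply/ord_geZ/ord_ge_quot.
rewrite /splitting_error opprD addrACA -addn2; apply: ord_geD.
  rewrite -sumrB; apply: ord_ge_sum => j _; rewrite -scalerBr; apply: ord_geZ.
  have -> : u j * u j - u' j * u' j = (u j - u' j) * (u j + u' j) by ring.
  by apply: ord_geM => //; exact: ord_geD.
apply: ord_ge_subst_sub => // j; try exact: ord_ge1_shift.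
by rewrite opprD addrACA subrr add0r.
Qed.

Lemma splitting_error_norm u e M r rho : 0 < r -> 0 <= rho <= r -> 2 * r <= e ->
  (forall i, ord_ge 2 (u i)) -> (forall i, norm_le r (u i) rho) ->
  norm_le e C M ->
  norm_le r (splitting_error u)
    (\sum_(i < n | (i < k)%N) `|a i| * (rho * rho) + (2 * r / e) ^+ 3 * M).
Proof.
move=> r0 /andP[rho0 rho_r] re u2 u_rho CM; have r0' := ltW r0.
have e0 : 0 < e by apply: lt_le_trans re; rewrite mulr_gt0.
apply: norm_leD => //.
  by apply: norm_le_sum => // i _; apply/norm_leZ/norm_leM.
apply: (@norm_le_subst _ _ _ _ _ _ (2 * r)) => //; first by rewrite mulr_ge0.
- by move=> i; exact: ord_ge1_shift.
- move=> i; apply: (@norm_leW _ _ _ _ (r + rho)).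
    by rewrite mulr2n mulrDl mul1r lerD2l.
  by apply: norm_leD => //; exact: norm_le_var.
- by apply: norm_le_shrink => //; rewrite re mulr_ge0.
Qed.

(** On the polydisc of radius [r] the operator preserves the ball of radius
[rho = r / D]: the term quadratic in [u] is small because [D] is large, and the
term from [C] because [r] is small compared with [1 / D]. *)
Lemma splitting_solution : exists u : 'I_n -> fps n K,
  [/\ forall i, is_convergent (u i), forall i, ord_ge 2 (u i)
    & forall i, splitting_operator u i = u i].
Proof.
have /is_convergentP[e [M [e0 CM]]] := Cc; have M0 := norm_le_ge0 CM.
pose A := \sum_(i < n | (i < k)%N) `|a i|.
pose B := \sum_(i < n | (i < k)%N) `|(2 * a i)^-1|.
have A0 : 0 <= A by exact: sumr_ge0.
have B0 : 0 <= B by exact: sumr_ge0.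
(* The image has norm at most [B (A rho^2 + (2 r / e)^3 M) / r]; with this [D]
   the first term is at most [rho / 2], and the bound below on the radius makes
   the second at most [rho / 2]. *)
pose D := 1 + 2 * B * A; have D1 : 1 <= D by rewrite lerDl !mulr_ge0.
have D0 : 0 < D by exact: lt_le_trans D1.
have [] := @small_radius K (e / 2) (16 * B * M * D / e ^+ 3).
- by rewrite divr_gt0.
- by rewrite divr_ge0 ?exprn_ge0 ?(ltW e0) // !mulr_ge0 // ltW.
move=> r [r0 re r1]; have r0' := ltW r0; pose rho := r / D.
have rho0 : 0 <= rho <= r.
  by rewrite divr_ge0 ?(ltW D0) //= ler_pdivrMr // ler_peMr.
have re' : 2 * r <= e by rewrite mulrC -ler_pdivlMr.
have [rho_ge0 _] := andP rho0.
have [u u_ball|d u u'|u [u_ball uT]] :=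
  @fixed_point n n K splitting_operator 2 r rho rho_ge0.
- move=> i; have u2 j : ord_ge 2 (u j) by have [] := u_ball j.
  split; first exact: splitting_operator_ord.
  rewrite /splitting_operator; case: ifP => ik; last exact: norm_le_zero.
  have u_rho j : norm_le r (u j) rho by have [] := u_ball j.
  have := splitting_error_norm r0 rho0 re' u2 u_rho CM.
  rewrite -mulr_suml -/A => /(norm_le_quot i r0)/(norm_leZ (- (2 * a i)^-1)).
  apply: norm_leW; rewrite normrN.
  apply: (@le_trans _ _ (B * ((A * (rho * rho) + (2 * r / e) ^+ 3 * M) / r))).
    apply: ler_wpM2r; last by rewrite /B (bigD1 i) //= lerDl sumr_ge0.
    apply: divr_ge0 => //; apply: addr_ge0; apply: mulr_ge0 => //.
      exact: mulr_ge0.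
    apply: exprn_ge0.
    by rewrite divr_ge0 ?(ltW e0) // mulr_ge0.
  have -> : B * ((A * (rho * rho) + (2 * r / e) ^+ 3 * M) / r) =
      rho * (2 * B * A / D + 16 * B * M * D / e ^+ 3 * r) / 2.
    by rewrite /rho; field; rewrite !gt_eqF.
  rewrite -mulrA ler_piMr // ler_pdivrMr // mul1r.
  rewrite (_ : 2 = 1 + 1) //; apply: lerD => //.
  by rewrite ler_pdivrMr // mul1r lerDr.
- exact: splitting_operator_contract.
exists u; split=> // i; last by have [] := u_ball i.
by apply/is_convergentP; exists r, rho; have [] := u_ball i.
Qed.

End Equation.

(** The substitution [x_i |-> x_i + u_i] has linear part the identity, hence is
an automorphism, and the remainder of the error is the residual part. *)
Lemma splitting (c : cps n K) : ord_ge 3 (coef c) ->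
  exists (phi : {lrmorphism cps n K -> cps n K}) (g : cps (n - k) K),
    [/\ is_local phi, bijective phi, ord_ge 3 (coef g)
      & phi (\sum_(i < n | (i < k)%N) a i *: cps_var K i ^+ 2 + c) =
        \sum_(i < n | (i < k)%N) a i *: cps_var K i ^+ 2 + cps_tail g].
Proof.
move=> c3; have [u [uc u2 uT]] := splitting_solution c3 (is_convergent_coef c).
have /choice[U UE] i := cps_of_convergent (uc i).
have U_max i : cps_var K i + U i \in @cps_max n K.
  by apply/cps_maxP; rewrite cpsDE UE; exact: ord_ge1_shift.
have [phi [phi1 phi_var phiE]] := local_of_vars U_max.
pose w : cps n K := \sum_(i < n | (i < k)%N) a i *: (U i * U i) + phi c.
have wE : coef w = splitting_error (coef c) u.
  rewrite /splitting_error cpsDE phiE cps_sumE; congr (_ + _).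
    by apply: eq_bigr => i _; rewrite cpsZE cpsME UE.
  by congr (fps_subst _ _); apply/funext => i; rewrite cpsDE UE.
have w3 : ord_ge 3 (coef w) by rewrite wE; exact: ord_ge3_splitting_error.
have rc : is_convergent (fps_rem k (coef w)).
  have /is_convergentP[r [M [r0 wM]]] := is_convergent_coef w.
  apply/is_convergentP; exists r, M; split=> //; apply: norm_le_rem => //;
    exact: ltW.
have [R RE] := cps_of_convergent rc.
have [||g [g3 gE]] := @head_free_is_tail n k K R 3.
- by rewrite RE; exact: ord_ge_rem.
- by move=> m hm; rewrite RE /fps_rem (negbTE hm).
exists phi, g; split=> //.
  apply: local_bijective => //; rewrite (_ : jacobian phi = 1%:M) ?unitmx1 //.
  apply/matrixP => i j; rewrite -jacobian_id !mxE phi_var cpsDE fps_addE UE.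
  by rewrite [u i _]u2 ?addr0 ?mdeg1.
have UT (i : 'I_n) : (i < k)%N -> U i = - (2 * a i)^-1 *: cps_quot i w.
  move=> ik; apply: cps_inj; rewrite UE -uT /splitting_operator ik -wE.
  by rewrite cpsZE coef_quot.
have wR : w = \sum_(i < n | (i < k)%N) cps_var K i * cps_quot i w + R.
  apply: cps_inj; rewrite [RHS]cpsDE cps_sumE RE; exact: fps_division.
rewrite gE rmorphD rmorph_sum.
apply: (@etrans _ _ (\sum_(i < n | (i < k)%N) a i *: cps_var K i ^+ 2 +
   (\sum_(i < n | (i < k)%N) (2 * a i) *: (cps_var K i * U i) + w))).
  rewrite /w !addrA -!big_split /=; congr (_ + _); apply: eq_bigr => i _.
  rewrite linearZ /= rmorphXn /= phi_var.
  have -> : 2 * a i = a i + a i by ring.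
  by rewrite scalerDl -!scalerDr; congr (_ *: _); ring.
congr (_ + _); rewrite {1}wR addrA -big_split big1 ?add0r // => i ik /=.
rewrite UT // -scalerAr scalerA mulrN divff ?scaleN1r ?addNr //.
by rewrite mulf_neq0 ?pnatr_eq0 ?a_neq0.
Qed.

End Splitting.

(** * Uniqueness of the residual part *)

Section RightEquivalence.
Context (n : nat) (K : numFieldType).
Implicit Types f g h : cps n K.

Lemma right_equiv_sym f g : right_equiv f g -> right_equiv g f.
Proof.
move=> [phi [phi_bij phi1 <-]].
have [psi [phiK psiK]] := lrmorphism_inv phi_bij.
by exists psi; split; [exists phi|exact: local_inv phi1 psiK|exact: phiK].
Qed.

Lemma right_equiv_trans f g h : right_equiv f g -> right_equiv g h ->
  right_equiv f h.
Proof.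
move=> [phi [phi_bij phi1 <-]] [psi [psi_bij psi1 <-]].
exists (psi \o phi); split=> //; first exact: bij_comp.
exact: local_comp.
Qed.

End RightEquivalence.

Section HeadBlock.
Context (n k : nat) (K : fieldType).

(** With all [a i = 1] this is the projector onto the first [k] variables. Working
with projectors avoids splitting the index [n] as [k + (n - k)]. *)
Definition head_mx (a : 'I_n -> K) :
  'M[K]_n := diag_mx (\row_i (a i *+ (i < k)%N)).

Lemma head_mx_mul a b : head_mx a *m head_mx b = head_mx (fun i => a i * b i).
Proof.
rewrite mulmx_diag; congr diag_mx; apply/rowP => i; rewrite !mxE.
by case: (i < k)%N; rewrite ?mulr1n ?mulr0n ?mulr0.
Qed.

Lemma tr_head_mx a : (head_mx a)^T = head_mx a.
Proof. exact: tr_diag_mx. Qed.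

Lemma eq_head_mx a b : (forall i : 'I_n, (i < k)%N -> a i = b i) ->
  head_mx a = head_mx b.
Proof.
move=> ab; congr diag_mx; apply/rowP => i; rewrite !mxE.
by case: (boolP (i < k)%N) => [/ab ->|]; rewrite ?mulr0n.
Qed.

(** Write [A] and [B] for the upper blocks of [L], of width [k] and [n - k]. Then
[A^T a A = b] shows that [A] is invertible, and [A^T a B = 0] that [B] vanishes;
[W] is the inverse of [A] extended by 0. *)
Lemma congruence_head_block a b (L : 'M[K]_n) (P := head_mx (fun=> 1)) :
  (forall i : 'I_n, (i < k)%N -> b i != 0) ->
  L^T *m head_mx a *m L = head_mx b ->
  exists W, [/\ W *m P = W, W *m L = P & P *m L *m (1%:M - P) = 0].
Proof.
move=> b0 LaL; pose B := head_mx (fun i => (b i)^-1).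
pose W := B *m L^T *m head_mx a.
have PP : P *m P = P by rewrite head_mx_mul; apply: eq_head_mx => i _;
  rewrite mulr1.
have aP : head_mx a *m P = head_mx a.
  by rewrite head_mx_mul; apply: eq_head_mx => i _; rewrite mulr1.
have Bb : B *m head_mx b = P.
  by rewrite head_mx_mul; apply: eq_head_mx => i ik; rewrite mulVf ?b0.
have PB : P *m B = B by rewrite head_mx_mul; apply: eq_head_mx => i _;
  rewrite mul1r.
have WP : W *m P = W by rewrite /W -mulmxA aP.
have PW : P *m W = W by rewrite /W !mulmxA PB.
have WL : W *m L = P by rewrite /W -!mulmxA (mulmxA L^T) LaL.
clearbody W; have [N NE] : exists N :
  'M[K]_n, N = 1%:M - P by exists (1%:M - P).
have PN : P *m N = 0 by rewrite NE mulmxBr mulmx1 PP subrr.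
have NP : N *m P = 0 by rewrite NE mulmxBl mul1mx PP subrr.
have NN : N *m N = N by rewrite {2}NE mulmxBr mulmx1 NP subr0.
have WN : W *m N = 0 by rewrite -WP -mulmxA PN mulmx0.
have NW : N *m W = 0 by rewrite -PW mulmxA NP mul0mx.
(* In the corner ring P M P, a left inverse is a right inverse. *)
have YX : (W + N) *m (P *m L *m P + N) = 1%:M.
  rewrite mulmxDl !mulmxDr WN NN !mulmxA NP !mul0mx WP WL PP addr0 add0r NE.
  by rewrite addrC subrK.
have PLW : P *m L *m W = P.
  have := congr1 (mulmx P) (mulmx1C YX).
  rewrite mulmx1 mulmxDl !mulmxDr NW NN -!(mulmxA _ P) PW PN !mulmx0 addr0
    add0r.
  by rewrite !mulmxA PP addr0.
exists W; split=> //.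
have {1}-> : P *m L = P *m L *m W *m L by rewrite PLW.
by rewrite -NE -!mulmxA (mulmxA W) WL PN !mulmx0.
Qed.

End HeadBlock.

Section QuadraticForm.
Context (n : nat) (K : numFieldType).

Lemma quadratic_form_head k (a : 'I_n -> K) :
  quadratic_form (head_mx k a) =
    \sum_(i < n | (i < k)%N) a i *: cps_var K i ^+ 2.
Proof.
rewrite [RHS]big_mkcond; apply: eq_bigr => i _.
rewrite (bigD1 i) //= big1 => [|j ji]; last first.
  by rewrite !mxE eq_sym (negbTE ji) scale0r.
by rewrite !mxE eqxx addr0 mulr1n; case: ifP; rewrite ?mulr1n // mulr0n scale0r.
Qed.

Lemma hessian_head k (a : 'I_n -> K) (g : cps n K) : ord_ge 3 (coef g) ->
  hessian (\sum_(i < n | (i < k)%N) a i *: cps_var K i ^+ 2 + g) =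
    2 *: head_mx k a.
Proof.
move=> g3; rewrite hessianD (hessian_ord3 g3) addr0 -quadratic_form_head.
by rewrite hessian_quadratic_form tr_head_mx scaler_nat mulr2n.
Qed.

Lemma ord_ge2_head k (a : 'I_n -> K) (g : cps n K) : ord_ge 3 (coef g) ->
  ord_ge 2 (coef (\sum_(i < n | (i < k)%N) a i *: cps_var K i ^+ 2 + g)).
Proof.
move=> g3; rewrite -quadratic_form_head cpsDE; apply: ord_geD.
  exact: ord_ge2_quadratic_form.
exact: ord_geW g3.
Qed.

Lemma lrmorph_quadratic_form (A : comAlgType K)
  (chi : {lrmorphism cps n K -> A}) S :
  chi (quadratic_form S) =
  \sum_i \sum_j S i j *: (chi (cps_var K i) * chi (cps_var K j)).
Proof.
rewrite rmorph_sum; apply: eq_bigr => i _; rewrite rmorph_sum.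
by apply: eq_bigr => j _; rewrite /= linearZ /= rmorphM.
Qed.

Lemma quadratic_congruence (A : comAlgType K) (S L : 'M[K]_n) (v : 'I_n -> A) :
  \sum_i \sum_j S i j *: ((\sum_l L i l *: v l) * (\sum_l L j l *: v l)) =
  \sum_i \sum_j (L^T *m S *m L) i j *: (v i * v j).
Proof.
under [RHS]eq_bigr do under eq_bigr do rewrite congruence_coef scaler_suml.
under [RHS]eq_bigr do rewrite exchange_big.
rewrite [RHS]exchange_big; apply: eq_bigr => i _ /=.
under [RHS]eq_bigr do under eq_bigr do rewrite scaler_suml.
under [RHS]eq_bigr do rewrite exchange_big.
rewrite [RHS]exchange_big; apply: eq_bigr => j _ /=.
rewrite big_distrlr /= scaler_sumr; apply: eq_bigr => l _.
rewrite scaler_sumr; apply: eq_bigr => m _.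
by rewrite -scalerAl -scalerAr !scalerA mulrA.
Qed.

End QuadraticForm.

Section Uniqueness.
Context (n k : nat) (K : numFieldType) (a a' : 'I_n -> K)
  (g g' : cps (n - k) K).
Hypotheses (a'_neq0 : forall i : 'I_n, (i < k)%N -> a' i != 0).
Hypotheses (g3 : ord_ge 3 (coef g)) (g'3 : ord_ge 3 (coef g')).

Local Notation q a := (\sum_(i < n | (i < k)%N) a i *: cps_var K i ^+ 2).

(** Write [phi_i] for the image of [x_i] and [A] for the upper left block of the
Jacobian matrix of [phi]. The map [theta] substitutes for the first variables the
solution of [phi_i = - (A x)_i], [i < k], which exists since this system has
invertible linear part [2 A]. As [A] is an isometry from the form of [a'] to that
of [a], [theta] sends the image of the first form by [phi] and the
second form to the same series; what remains is an equality between [g']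
and the image of [g] under [theta \o phi] restricted to the last variables. *)
Lemma residual_unique :
  right_equiv (q a + cps_tail g) (q a' + cps_tail g') -> right_equiv g g'.
Proof.
move=> [phi [phi_bij phi1 phiE]]; pose L := jacobian phi.
pose P : 'M[K]_n := head_mx k (fun=> 1).
have [iota [iota1 iota_var iotaE]] := tail_embedding n k K.
have [pi [pi1 pi_tail pi_head]] := tail_projection n k K.
have t3 : ord_ge 3 (coef (cps_tail g)) by rewrite -iotaE; exact: local_ord.
have t'3 : ord_ge 3 (coef (cps_tail g')) by rewrite -iotaE; exact: local_ord.
have LaL : L^T *m head_mx k a *m L = head_mx k a'.
  have two0 : (2 : K) != 0 by rewrite pnatr_eq0.
  apply: (scalerI two0); rewrite -(hessian_head _ _ t'3) -phiE.
  rewrite hessian_local //; last exact: ord_ge2_head.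
  by rewrite hessian_head // -scalemxAr -scalemxAl.
have [W [WP WL PL]] := congruence_head_block a'_neq0 LaL.
have PE i j : P i j = (i == j)%:R *+ (i < k)%N.
  by rewrite !mxE; case: (i < k)%N; rewrite ?mul0rn ?mulr1n.
(* The system to solve, completed by the last variables into a coordinate
   change; by [PL] the linear part of [phi_i], [i < k], involves only the first
   variables. *)
pose h (i : 'I_n) :=
  if (i < k)%N then phi (cps_var K i) + linear_form (L i) else cps_var K i.
have h_max i : h i \in @cps_max n K.
  rewrite /h; case: ifP => _; last exact: cps_max_var.
  apply/cps_maxP; rewrite cpsDE; apply: ord_geD; first exact: local_var.
  by apply/cps_maxP; exact: linear_form_max.
have [Phi [Phi1 Phi_var _]] := local_of_vars h_max.
pose N := 1%:M - P; rewrite -/P in WP WL PL; rewrite -/N in PL.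
have jPhi : jacobian Phi = 2 *: (P *m L) + N.
  apply/matrixP => i j; rewrite /N /P mul_diag_mx -/P [LHS]mxE Phi_var /h.
  rewrite !mxE; case: (i < k)%N; rewrite ?mulr1n ?mulr0n.
    rewrite cpsDE fps_addE linear_form_lin mxE subrr addr0 mul1r.
    by rewrite mulr2n mulrDl mul1r.
  by rewrite mul0r mulr0 add0r mul0rn subr0 /= /fps_var eq_mnm1 eq_sym.
have PP : P *m P = P by rewrite head_mx_mul; apply: eq_head_mx => i _;
  rewrite mulr1.
have PN : P *m N = 0 by rewrite mulmxBr mulmx1 PP subrr.
have NP : N *m P = 0 by rewrite mulmxBl mul1mx PP subrr.
have NN : N *m N = N by rewrite {2}/N mulmxBr mulmx1 NP subr0.
have PaddN : P + N = 1%:M by rewrite addrC subrK.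
have NijE i j : N i j = (i == j)%:R *+ (k <= i)%N.
  rewrite !mxE ltnNge; case: (k <= i)%N; last by rewrite subrr.
  by rewrite mul0rn subr0.
clearbody N P.
have WN : W *m N = 0 by rewrite -WP -mulmxA PN mulmx0.
(* [W] inverts [P L] on the first variables, [N] is the identity on the last. *)
have NM : (2^-1 *: W + N) *m jacobian Phi = 1%:M.
  rewrite jPhi mulmxDl !mulmxDr -!scalemxAl -!scalemxAr WN NN !mulmxA NP mul0mx
    WP WL.
  by rewrite !scaler0 addr0 add0r scalerA mulVf ?scale1r // pnatr_eq0.
have [|theta0 [PhiK theta0K]] := @lrmorphism_inv _ _ _ Phi _.
  by apply: local_bijective => //; have [] := mulmx1_unit NM.
have theta01 := local_inv Phi1 theta0K.
pose theta : {lrmorphism cps n K -> cps (n - k) K} := pi \o theta0.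
have theta1 : is_local theta by exact: local_comp.
have thetaPhi f : theta (Phi f) = pi f by rewrite /= PhiK.
clearbody theta.
have theta_Phi i : theta (h i) = pi (cps_var K i) by rewrite -Phi_var thetaPhi.
have theta_tail j : theta (cps_var K (@tail_ord n k j)) = cps_var K j.
  by rewrite -pi_tail -theta_Phi /h tail_ord_ge.
have theta_head (i : 'I_n) : (i < k)%N ->
    theta (phi (cps_var K i)) = - \sum_j L i j *: theta (cps_var K j).
  move=> ik; have := theta_Phi i; rewrite pi_head // /h ik rmorphD rmorph_sum.
  move/eqP; rewrite addr_eq0 => /eqP ->; congr (- _).
  by apply: eq_bigr => j _; rewrite /= !linearZ.
have iota_section (chi : {lrmorphism cps n K -> cps (n - k) K}) :
  is_local chi ->
    (forall j, chi (cps_var K (@tail_ord n k j)) = cps_var K j) ->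
      chi \o iota =1 id.
  pose id' : {lrmorphism cps (n - k) K -> cps (n - k) K} := idfun.
  move=> chi1 chi_tail; apply: (@local_ext _ _ _ (chi \o iota) id') => // [|j].
    exact: local_comp.
  by rewrite /= iota_var; exact: chi_tail.
pose sigma : {lrmorphism cps (n - k) K -> cps (n - k) K} :=
  theta \o (phi \o iota).
have sigma1 : is_local sigma.
  by apply: local_comp => //; apply: local_comp.
have PE0 : P *m jacobian pi = 0.
  apply/matrixP => i j; rewrite mxE big1 ?mxE // => l _.
  rewrite PE [jacobian _ _ _]mxE; have [<-|_] := eqVneq i l;
    last by rewrite mul0rn mul0r.
  case: (boolP (i < k)%N) => [/pi_head ->|_]; last by rewrite mulr0n mul0r.
  by rewrite mulr0.
have NE : N *m jacobian pi = jacobian pi.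
  by rewrite -[RHS]mul1mx -PaddN mulmxDl PE0 add0r.
have jac_theta : jacobian theta = jacobian pi.
  have jE : jacobian Phi *m jacobian theta = jacobian pi.
    by rewrite -jacobian_comp //; exact: eq_jacobian.
  rewrite -[LHS]mul1mx -NM -mulmxA jE mulmxDl NE -scalemxAl -WP -mulmxA PE0.
  by rewrite mulmx0 scaler0 add0r.
(* [theta] and the projection have the same linear part, so the Jacobian matrix
   of [sigma] is the lower right block of [L]; its inverse is that of [L^-1]. *)
have sigma_unit : jacobian sigma \in unitmx.
  have [psi [phiK psiK]] := lrmorphism_inv phi_bij;
    have psi1 := local_inv phi1 psiK.
  have L'L : jacobian psi *m L = 1%:M.
    by rewrite -jacobian_comp // -jacobian_id; apply: eq_jacobian => f;
      exact: psiK.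
  have jsigma : jacobian sigma = jacobian iota *m (L *m jacobian pi).
    rewrite (@jacobian_comp _ _ _ _ (phi \o iota) theta) //;
      last exact: local_comp.
    by rewrite (@jacobian_comp _ _ _ _ iota phi) // jac_theta -mulmxA.
  have jpi_iota : jacobian iota *m jacobian pi = 1%:M.
    by rewrite -jacobian_comp // -jacobian_id; apply/eq_jacobian/iota_section.
  have jiota_pi : jacobian pi *m jacobian iota = N.
    rewrite -jacobian_comp //; apply/matrixP => i j; rewrite mxE NijE /=.
    have [le_ki|lt_ik] := leqP k i; last by rewrite pi_head // rmorph0.
    have [l ->] := tail_ordP le_ki;
      rewrite pi_tail iota_var /= /fps_var eq_mnm1.
    by rewrite eq_sym.
  suff /mulmx1_unit[] : (jacobian iota *m jacobian psi *m jacobian pi) *m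
    jacobian sigma
    = 1%:M by [].
  rewrite jsigma mulmxA -(mulmxA _ (jacobian pi)) jiota_pi.
  (* The projector [N] can be dropped since [P L N = 0]. *)
  have -> : (jacobian iota *m jacobian psi *m N) *m (L *m jacobian pi) =
      jacobian iota *m jacobian psi *m (L *m jacobian pi).
    rewrite -mulmxA; congr (_ *m _).
    rewrite -[RHS]mul1mx -PaddN mulmxDl -{2}NE !mulmxA PL mul0mx add0r.
    by rewrite -!mulmxA.
  by rewrite -mulmxA (mulmxA _ L) L'L mul1mx.
exists sigma; split=> //; first exact: local_bijective.
have := congr1 theta phiE; rewrite -!quadratic_form_head !rmorphD /=.
have -> : theta (cps_tail g') = g' by rewrite -iotaE;
  exact: iota_section theta_tail _.
rewrite -(iotaE g) => e; apply: (addrI (theta (quadratic_form (head_mx k a')))).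
rewrite -e; congr (_ + _).
rewrite lrmorph_quadratic_form -LaL -quadratic_congruence.
have /= -> := lrmorph_quadratic_form (theta \o phi) (head_mx k a).
apply: eq_bigr => i _; apply: eq_bigr => j _.
rewrite !mxE /=; have [<-|_] := eqVneq i j; last by rewrite !scale0r.
case: (boolP (i < k)%N) => [ik|_]; last by rewrite !mulr0n !scale0r.
by rewrite theta_head // mulrNN.
Qed.

End Uniqueness.

(** * Existence of the normal form *)

Section Existence.
Context (n : nat) (K : numFieldType) (good : K -> Prop).
Hypothesis good_neq0 : forall c, good c -> c != 0.
Hypothesis goodP : forall x : K, x != 0 -> exists2 y, y != 0 & good (y * y * x).

(** The substitution is linear: it diagonalises half the Hessian, which is the
matrix of the quadratic part. *)
Lemma right_equiv_diagonal (f : cps n K) (k := \rank (hessian f)) :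
  ord_ge 2 (coef f) ->
  exists a c, [/\ forall i : 'I_n, (i < k)%N -> good (a i), ord_ge 3 (coef c)
    & right_equiv f (\sum_(i < n | (i < k)%N) a i *: cps_var K i ^+ 2 + c)].
Proof.
move=> f2; pose S := 2^-1 *: hessian f.
have two0 : (2 : K) != 0 by rewrite pnatr_eq0.
have sS : S^T = S by rewrite linearZ /= tr_hessian.
have rS : \rank S = k by rewrite mxrank_scale_nz // invr_eq0.
have [P [a [P_unit good_a aE]]] := symmetric_diagonalize two0 goodP sS.
rewrite rS in good_a aE.
have [phi [phi1 phi_var _]] := local_of_vars (fun i => linear_form_max (P^T i)).
have jphi : jacobian phi = P^T.
  by apply/matrixP => i j; rewrite mxE phi_var linear_form_lin.
have phi_bij : bijective phi by apply: local_bijective;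
  rewrite ?jphi ?unitmx_tr.
have fE : 2^-1 *: hessian (phi f) = head_mx k a.
  by rewrite hessian_local // jphi trmxK scalemxAl scalemxAr.
have := quadratic_part (local_ord phi1 f2); rewrite fE quadratic_form_head.
set c := _ - _ => c3; exists a, c; split=> //.
by exists phi; split=> //; rewrite addrC subrK.
Qed.

Lemma splitting_exists (f : cps n K) (k := \rank (hessian f)) :
  ord_ge 2 (coef f) ->
  exists a (g : cps (n - k) K),
    [/\ forall i : 'I_n, (i < k)%N -> good (a i), ord_ge 3 (coef g)
    & right_equiv f (\sum_(i < n | (i < k)%N) a i *: cps_var K i ^+ 2 +
      cps_tail g)].
Proof.
move=> /right_equiv_diagonal[a [c [good_a c3 fc]]].
have a0 (i : 'I_n) : (i < k)%N -> a i != 0 by move=> /good_a/good_neq0.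
have [phi [g [phi1 phi_bij g3 phiE]]] := splitting (rank_leq_row _) a0 c3.
exists a, g; split=> //; apply: right_equiv_trans fc _.
by exists phi.
Qed.

End Existence.

Section Squares.
Context (R : realType) (b : base_field).

Lemma square_coef_neq0 (c : scalars R b) : square_coef c -> c != 0.
Proof.
case: b c => c /= => [[->|->]|->]; rewrite ?oppr_eq0; exact: oner_neq0.
Qed.

(** Scale by the inverse of a square root of [x], or of its absolute value over
the reals. *)
Lemma square_coefP (x : scalars R b) : x != 0 ->
  exists2 y, y != 0 & square_coef (y * y * x).
Proof.
case: b x => /= x x0.
  have nx0 : `|x| != 0 by rewrite normr_eq0.
  have s0 : Num.sqrt `|x| != 0 by rewrite sqrtr_eq0 -ltNge lt0r nx0 normr_ge0.
  exists (Num.sqrt `|x|)^-1; first by rewrite invr_eq0.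
  rewrite -invfM -expr2 sqr_sqrtr //; case: (ltP x 0) => [xlt|xge];
    [right|left].
    by rewrite ltr0_norm // invrN mulNr mulVf.
  by rewrite ger0_norm // mulVf.
exists (sqrtC x)^-1; first by rewrite invr_eq0 sqrtC_eq0.
by rewrite -invfM -expr2 sqrtCK mulVf.
Qed.

End Squares.

Theorem theorem2p4 (R : realType) (b : base_field) (n k : nat)
    (f : cps n (scalars R b)) :
  ideal_pow (@cps_max n (scalars R b)) 2 f ->
  \rank (hessian f) = k ->
  (exists (a : 'I_n -> scalars R b) (g : cps (n - k) (scalars R b)),
    [/\ forall i : 'I_n, (i < k)%N -> square_coef (a i),
        ideal_pow (@cps_max (n - k) (scalars R b)) 3 g
      & right_equiv f
          (\sum_(i < n | (i < k)%N) a i *: cps_var (scalars R b) i ^+ 2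
           + cps_tail g)])
  /\
  (forall (a a' : 'I_n -> scalars R b) (g g' : cps (n - k) (scalars R b)),
    (forall i : 'I_n, (i < k)%N -> square_coef (a i)) ->
    (forall i : 'I_n, (i < k)%N -> square_coef (a' i)) ->
    ideal_pow (@cps_max (n - k) (scalars R b)) 3 g ->
    ideal_pow (@cps_max (n - k) (scalars R b)) 3 g' ->
    right_equiv f
      (\sum_(i < n | (i < k)%N) a i *: cps_var (scalars R b) i ^+ 2
       + cps_tail g) ->
    right_equiv f
      (\sum_(i < n | (i < k)%N) a' i *: cps_var (scalars R b) i ^+ 2
       + cps_tail g') ->
    right_equiv g g').
Proof.
move=> /ideal_powP f2 <-; split.
  have [a [g [good_a g3 fg]]] :=
    splitting_exists (@square_coef_neq0 R b) (@square_coefP R b) f2.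
  by exists a, g; split=> //; apply/ideal_powP.
move=> a a' g g' _ sq_a' /ideal_powP g3 /ideal_powP g'3 fg fg'.
apply: (residual_unique _ g3 g'3); last first.
  exact: right_equiv_trans (right_equiv_sym fg) fg'.
by move=> i /sq_a'/square_coef_neq0.
Qed.
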